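(* Let $P,Q\subset\mathbb{R}^d$ be non-empty lattice polytopes. Then $P\mapsto\tilde\chi(\mathcal{C}_Q(P))$ defines a valuation on $\mathcal{P}(\mathbb{Z}^d)$, and $$E_{P,Q}(-1,1)=-\sum_{p\in\mathbb{Z}^d}\tilde\chi(\mathcal{C}_Q(P+p)).$$
   Context: $\mathcal{P}(\mathbb{Z}^d)$ denotes the set of lattice polytopes (convex hulls of finitely many points of $\mathbb{Z}^d$). For lattice polytopes $P,Q$, the function $(m,n)\mapsto|(mP+nQ)\cap\mathbb{Z}^d|$ on $\mathbb{Z}_{\ge0}^2$ (with $+$ the Minkowski sum) agrees with a polynomial in $(m,n)$; $E_{P,Q}$ denotes this polynomial. The $Q$-complement of $P$ is the polyhedral complex $\mathcal{C}_Q(P)=\{F\subseteq P \text{ face}: F\cap Q=\emptyset\}$ (faces include the empty face, of dimension $-1$). The reduced Euler characteristic of a polyhedral complex $\mathcal{K}$ is $\tilde\chi(\mathcal{K})=\sum_{F\in\mathcal{K}}(-1)^{\dim F}$. *)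

(* Defs.v *)
From HB Require Import structures.
From mathcomp Require Export all_boot all_order all_algebra finmap.
From mathcomp Require Export mathcomp_extra boolp classical_sets functions.
From mathcomp Require Export cardinality fsbigop reals convex.

Set Implicit Arguments.
Unset Strict Implicit.
Unset Printing Implicit Defensive.

Export GRing.Theory Num.Theory.

Local Open Scope classical_set_scope.
Local Open Scope ring_scope.

Section Polytopes.
Context {R : realType} {d : nat}.
Implicit Types (A P Q F : set 'rV[R]_d) (K : set (set 'rV[R]_d)).

Definition lattice_point (z : 'rV[int]_d) : 'rV[R]_d := map_mx intr z.

Definition convex_hull A : set 'rV[R]_d :=
  smallest (@convex_set R 'rV[R]_d) A.

(* The empty set is a lattice polytope (take S empty). *)
Definition lattice_polytope P : Prop :=
  exists2 S : set 'rV[int]_d,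
    finite_set S & P = convex_hull (lattice_point @` S).

Definition dilate (m : nat) P : set 'rV[R]_d := [set m%:R *: x | x in P].

Definition minkowski_sum P Q : set 'rV[R]_d :=
  [set x + y | x in P & y in Q].

Definition translate (p : 'rV[int]_d) P : set 'rV[R]_d :=
  [set x + lattice_point p | x in P].

Definition lattice_count A : nat :=
  #|` fset_set [set z | A (lattice_point z)]|.

(* The inequality u x <= c is valid on P and F is where it is tight; u = 0
   gives the face P (c = 0) and the empty face (c = 1). *)
Definition face P F : Prop :=
  exists (u : 'cV[R]_d) (c : R),
    (forall x, P x -> (x *m u) 0 0 <= c) /\
    F = [set x | P x /\ (x *m u) 0 0 = c].

(* Linear span of A - A, that is, the direction of the affine hull of A. *)
Definition direction A : {vspace 'rV[R]_d} :=
  xget 0%VS [set U : {vspace 'rV[R]_d} |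
    (forall x y, A x -> A y -> x - y \in U) /\
    forall V : {vspace 'rV[R]_d},
      (forall x y, A x -> A y -> x - y \in V) -> (U <= V)%VS].

Definition affine_dim A : int :=
  if A == set0 then -1 else (\dim (direction A))%:Z.

Definition complement_complex Q P : set (set 'rV[R]_d) :=
  [set F | face P F /\ F `&` Q = set0].

Definition reduced_euler K : int :=
  \sum_(F \in K) (-1 : int) ^ affine_dim F.

Definition is_valuation (G : zmodType) (phi : set 'rV[R]_d -> G) : Prop :=
  phi set0 = 0 /\
  forall P1 P2, lattice_polytope P1 -> lattice_polytope P2 ->
    lattice_polytope (P1 `|` P2) -> lattice_polytope (P1 `&` P2) ->
    phi (P1 `|` P2) = phi P1 + phi P2 - phi (P1 `&` P2).

(* The value at the empty polytope is the normalisation required of a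
   valuation: the complex of the empty polytope is {empty face}, whose reduced
   Euler characteristic is -1. *)
Definition complement_euler Q P : int :=
  if P == set0 then 0 else reduced_euler (complement_complex Q P).

(* At most one E satisfies this, as a polynomial is determined by its values
   on pairs of natural numbers. *)
Definition is_ehrhart_polynomial P Q (E : {poly {poly R}}) : Prop :=
  forall m n : nat, E.[m%:R, n%:R] =
    (lattice_count (minkowski_sum (dilate m P) (dilate n Q)))%:R.

End Polytopes.

(* Main.v *)
(* For a nonempty polytope P with faces F, Euler's relation turns
   -chi~(C_Q(P)) into the sum of (-1)^(dim F) over the nonempty faces F meeting
   Q. The central fact is that the signed, reflected faces form the inverse of P
   for the Minkowski product of indicator functions:
     sum_F (-1)^(dim F) 1_(K + P - F) = 1_K   for every polyhedron K.
   The valuation property is then formal algebra: if P1 u P2 is convex then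
   (P1 u P2) + (P1 n P2) = P1 + P2, so the inverses of P1 u P2 and P1 n P2 add up
   to the inverses of P1 and P2. For the reciprocity, let H(m) be the signed count
   of lattice points sum_F (-1)^(dim F) |(Q + mP - F) n Z^d|. The inverse relation
   gives H(m+1) = |(Q + mP) n Z^d| = E(m, 1), and
   H(0) = - sum_p chi~(C_Q(P+p)). Finite differences of H of high order vanish,
   because prod_v ([P] - [v]) = 0 over the vertices v of P; hence H(0) = E(-1, 1).
   All identities between indicator functions are transported along projections
   by the compactly supported Euler characteristic, computed one line direction
   at a time. *)
Require Import Defs.
From mathcomp Require Import zify ring lra interval_inference.

Set Implicit Arguments.
Unset Strict Implicit.
Unset Printing Implicit Defensive.
Import Order.TTheory.

Local Open Scope classical_set_scope.
Local Open Scope ring_scope.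

(** * Euler characteristic of step functions on the line *)

(** The transport principle is that a linear relation between indicators of bounded polyhedra
    survives when each indicator is replaced by the truth value of nonemptiness. Intersecting first
    with [v - K] turns it into a relation between Minkowski sums with [K]. Relative interiors and
    half-open segments occur on the way, which is why the compactly supported Euler characteristic
    is used: it is additive over the strata of a polytope. Faces are indexed by sets of tight
    inequalities, so that dimensions, translates and tangent cones are all read off the same
    normals. In the reciprocity, cancellation needs a summand [P] and therefore says nothing about
    H(0), where only [Q] is left. Vanishing differences carry the values at m >= 1 back to 0. They
    are available with any polytope in place of [Q], so no Ehrhart polynomial besides the given E is
    constructed, and E enters only through its values. *)

Definition ind (P : Prop) : int := (`[< P >] : nat)%:Z.

Lemma indT (P : Prop) : P -> ind P = 1.
Proof. by move=> p; rewrite /ind asboolT. Qed.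

Lemma indF (P : Prop) : ~ P -> ind P = 0.
Proof. by move=> p; rewrite /ind asboolF. Qed.

Lemma ind_ext (P P' : Prop) : (P <-> P') -> ind P = ind P'.
Proof. by move=> /propext ->. Qed.

Section EulerLine.
Context {R : realType}.
Implicit Types (f g : R -> int) (c l : int).

Definition right_limit f g := forall t, exists2 e, 0 < e &
  forall s, t < s < t + e -> f s = g t.

Definition ninfty_limit f l := exists M, forall t, t < M -> f t = l.

(* [c] is the compactly supported Euler characteristic of the step function
   [f], written as the sum of the jumps of [f] at its right-discontinuities.
   Quantifying over all large enough supports makes additivity immediate. *)
Definition euler1 f c := exists g l (s0 : seq R),
  [/\ right_limit f g, ninfty_limit f l &
      forall s, uniq s -> {subset s0 <= s} ->
        c = \sum_(t <- s) (f t - g t) - l].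

(** The auxiliary data are forced by [f]: two right limits agree on a common right neighbourhood,
    two limits at minus infinity on a common ray. Both sums can then be taken over the union of the
    supports. *)
Lemma euler1_unique f c c' : euler1 f c -> euler1 f c' -> c = c'.
Proof.
move=> [g [l [s0 [fg fl cE]]]] [g' [l' [s0' [fg' fl' cE']]]].
have gE t : g t = g' t.
  have [e e0 He] := fg t; have [e' e'0 He'] := fg' t.
  have m0 : 0 < Num.min e e' by rewrite lt_min e0.
  rewrite -(He (t + Num.min e e' / 2)) ?(He' (t + Num.min e e' / 2)) //.
    have : Num.min e e' <= e' by rewrite ge_min lexx orbT.
    by move: m0; set m := Num.min _ _ => *; lra.
  have : Num.min e e' <= e by rewrite ge_min lexx.
  by move: m0; set m := Num.min _ _ => *; lra.
have lE : l = l'.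
  have [M HM] := fl; have [M' HM'] := fl'.
  rewrite -(HM (Num.min M M' - 1)) ?(HM' (Num.min M M' - 1)) //.
    have : Num.min M M' <= M' by rewrite ge_min lexx orbT.
    by lra.
  have : Num.min M M' <= M by rewrite ge_min lexx.
  by lra.
rewrite (cE (undup (s0 ++ s0'))) ?undup_uniq; first last.
- by move=> t ts; rewrite mem_undup mem_cat ts.
- by [].
rewrite (cE' (undup (s0 ++ s0'))) ?undup_uniq; first last.
- by move=> t ts; rewrite mem_undup mem_cat ts orbT.
- by [].
by rewrite lE; congr (_ - _); apply: eq_bigr => t _; rewrite gE.
Qed.

Lemma euler1D f f' c c' :
  euler1 f c -> euler1 f' c' -> euler1 (fun t => f t + f' t) (c + c').
Proof.
move=> [g [l [s0 [fg [M fl] cE]]]] [g' [l' [s0' [fg' [M' fl'] cE']]]].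
exists (fun t => g t + g' t), (l + l'), (s0 ++ s0'); split.
- move=> t; have [e e0 He] := fg t; have [e' e'0 He'] := fg' t.
  exists (Num.min e e') => [|s]; first by rewrite lt_min e0.
  move=> /andP[ts]; rewrite -ltrBlDl lt_min !ltrBlDl => /andP[s1 s2].
  by rewrite He ?ts// He' ?ts.
- by exists (Num.min M M') => t; rewrite lt_min => /andP[/fl-> /fl'->].
- move=> s us ss; rewrite (cE s) 1?(cE' s)//.
  + rewrite addrACA -opprD -big_split/=; congr (_ - _).
    by apply: eq_bigr => t _; rewrite addrACA -opprD.
  + by move=> t ts; apply: ss; rewrite mem_cat ts orbT.
  + by move=> t ts; apply: ss; rewrite mem_cat ts.
Qed.

Lemma euler1Z a f c : euler1 f c -> euler1 (fun t => a * f t) (a * c).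
Proof.
move=> [g [l [s0 [fg [M fl] cE]]]].
exists (fun t => a * g t), (a * l), s0; split.
- by move=> t; have [e e0 He] := fg t; exists e => // s /He->.
- by exists M => t /fl->.
- move=> s us ss; rewrite (cE s)// mulrBr mulr_sumr; congr (_ - _).
  by apply: eq_bigr => t _; rewrite mulrBr.
Qed.

(** The line has compactly supported Euler characteristic -1; this is what the term [- l] in
    [euler1] accounts for. *)
Lemma euler1_cst c : euler1 (fun=> c) (- c).
Proof.
exists (fun=> c), c, [::]; split.
- by move=> t; exists 1.
- by exists 0.
- by move=> s _ _; rewrite big1 ?sub0r// => t _; rewrite subrr.
Qed.

Lemma euler1_0 : euler1 (fun=> 0) 0.
Proof. by rewrite -[X in euler1 _ X]oppr0; exact: euler1_cst. Qed.

Lemma euler1_ge (a : R) : euler1 (fun t => ind (a <= t)) 0.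
Proof.
exists (fun t => ind (a <= t)), 0, [::]; split.
- move=> t; have [at_|ta] := leP a t.
    by exists 1 => // s /andP[ts _]; rewrite !indT//; lra.
  exists (a - t) => [|s /andP[_ ts]]; first by lra.
  by rewrite !indF//; apply/negP; rewrite -ltNge; lra.
- by exists a => t ta; rewrite indF//; apply/negP; rewrite -ltNge.
- by move=> s _ _; rewrite big1 ?subr0// => t _; rewrite subrr.
Qed.

Lemma euler1_gt (a : R) : euler1 (fun t => ind (a < t)) (- 1).
Proof.
exists (fun t => ind (a <= t)), 0, [:: a]; split.
- move=> t; have [at_|ta] := leP a t.
    by exists 1 => // s /andP[ts _]; rewrite !indT//; lra.
  exists (a - t) => [|s /andP[_ ts]]; first by lra.
  by rewrite !indF//; apply/negP; rewrite -leNgt; lra.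
- by exists a => t ta; rewrite indF//; apply/negP; rewrite -leNgt ltW.
- move=> s us ss; rewrite (bigD1_seq a)//=; last by apply: ss; rewrite inE.
  rewrite indF ?ltxx// indT ?lexx// big1 ?subr0// => t ta.
  rewrite /ind; rewrite lt_neqAle eq_sym ta/= subrr//.
Qed.

Lemma euler1_ext f f' c : f =1 f' -> euler1 f c -> euler1 f' c.
Proof. by move=> /funext->. Qed.

Lemma euler1_sum (I : Type) (r : seq I) (P : pred I) (a c : I -> int)
    (F : I -> R -> int) : (forall i, P i -> euler1 (F i) (c i)) ->
  euler1 (fun t => \sum_(i <- r | P i) a i * F i t) (\sum_(i <- r | P i) a i * c i).
Proof.
move=> h; elim: r => [|i r IH].
  by rewrite big_nil; apply: euler1_ext euler1_0 => t; rewrite big_nil.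
rewrite big_cons; case: (boolP (P i)) => Pi; last first.
  by apply: euler1_ext IH => t; rewrite big_cons (negbTE Pi).
apply: euler1_ext (euler1D (euler1Z (a i) (h i Pi)) IH) => t.
by rewrite big_cons Pi.
Qed.

(** The segment is the closed ray from [a] minus the open ray from [b], which gives 0 - (-1). *)
Lemma euler1_itv (a b : R) : a <= b -> euler1 (fun t => ind (a <= t <= b)) 1.
Proof.
move=> ab; rewrite (_ : 1 = 0 + (-1) * (-1))//.
apply: euler1_ext (euler1D (euler1_ge a) (euler1Z (-1) (euler1_gt b))) => t.
have [at_|ta] := leP a t; have [bt|tb] := ltP b t; rewrite /ind /= ?asboolb//=.
by exfalso; lra.
Qed.

Definition open1 (I : set R) := forall t, I t ->
  exists2 e, 0 < e & forall s, t - e < s < t + e -> I s.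

Definition interval1 (I : set R) := forall a b t, I a -> I b -> a <= t <= b -> I t.

(* The open interval is the difference of its upper closure, which is the line
   or an open upper ray, and of the set of its strict upper bounds, which is
   empty or a closed upper ray. *)
Lemma euler1_open (I : set R) : interval1 I -> open1 I -> I !=set0 ->
  euler1 (fun t => ind (I t)) (- 1).
Proof.
move=> itvI opI [t0 It0].
pose U t := exists2 s, I s & s <= t.
pose W t := forall s, I s -> s < t.
have opI' s : I s -> (exists2 r, I r & r < s) /\ (exists2 r, I r & s < r).
  move=> /opI[e e0 He]; split; [exists (s - e / 2)|exists (s + e / 2)];
    by [apply: He; lra|lra].
have eU : euler1 (fun t => ind (U t)) (- 1).
  have [lbI|nlb] := pselect (has_lbound I).
    apply: euler1_ext (euler1_gt (inf I)) => t; apply: ind_ext; split.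
      move=> it; have := @inf_adherent _ I (t - inf I).
      rewrite subr_gt0 => /(_ it) []; first by split => //; exists t0.
      by move=> s Is; rewrite subrKC => st; exists s => //; exact: ltW.
    move=> [s /opI'[[r Ir rs] _] st]; apply: le_lt_trans (lt_le_trans rs st).
    exact: ge_inf.
  apply: euler1_ext (euler1_cst 1) => t; rewrite indT//.
  apply: contrapT => nU; apply: nlb; exists t => s Is.
  by rewrite leNgt; apply/negP => st; apply: nU; exists s => //; exact: ltW.
have eW : euler1 (fun t => ind (W t)) 0.
  have [ubI|nub] := pselect (has_ubound I).
    apply: euler1_ext (euler1_ge (sup I)) => t; apply: ind_ext; split.
      move=> it s /opI'[_ [r Ir sr]]; apply: lt_le_trans sr _.
      by apply: le_trans it; exact: ub_le_sup.
    by move=> Wt; apply: ge_sup; [exists t0|move=> s /Wt/ltW].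
  apply: euler1_ext euler1_0 => t; rewrite indF//.
  by move=> Wt; apply: nub; exists t => s /Wt/ltW.
rewrite (_ : -1 = -1 + (-1) * 0); last by rewrite mulr0 addr0.
apply: euler1_ext (euler1D eU (euler1Z (-1) eW)) => t.
have [It|nIt] := pselect (I t).
  rewrite indT; last by exists t.
  rewrite indF; last by move=> /(_ _ It); rewrite ltxx.
  by rewrite indT.
rewrite (indF nIt).
have [Wt|nWt] := pselect (W t).
  rewrite indT ?indT//; exists t0 => //; exact/ltW/Wt.
rewrite indF ?indF// => -[s Is st]; apply: nWt => s' Is'.
rewrite ltNge; apply/negP => ts'; apply: nIt.
by apply: itvI Is Is' _; rewrite st.
Qed.

End EulerLine.

(** * Iterated Euler characteristic *)

Section EulerIterated.
Context {R : realType} {V : vectType R}.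
Implicit Types (f g : V -> int) (ws : seq V) (A O : set V) (U S : {vspace V}).

Definition line_integral (w : V) f g :=
  forall x, euler1 (fun t => f (x + t *: w)) (g x).

(** Iterated integration in the manner of Fubini. Each stage yields a function invariant along the
    direction just used, so once the directions span the space a constant remains, as the base case
    demands. Being a relation, it also records that every line integral exists. *)
Fixpoint euler ws f (c : int) : Prop :=
  if ws is w :: ws' then exists2 g, line_integral w f g & euler ws' g c
  else forall x, f x = c.

Lemma euler_unique ws f c c' : euler ws f c -> euler ws f c' -> c = c'.
Proof.
elim: ws f => [|w ws IH] f /=; first by move=> /(_ 0)<- /(_ 0).
move=> [g fg gc] [g' fg' gc']; apply: IH gc _.
rewrite (_ : g = g')//; apply/funext => x; exact: euler1_unique (fg x) (fg' x).
Qed.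

Lemma eulerD ws f f' c c' :
  euler ws f c -> euler ws f' c' -> euler ws (fun x => f x + f' x) (c + c').
Proof.
elim: ws f f' => [|w ws IH] f f' /=; first by move=> h h' x; rewrite h h'.
move=> [g fg gc] [g' fg' gc']; exists (fun x => g x + g' x); last exact: IH.
by move=> x; apply: euler1D.
Qed.

Lemma eulerZ ws a f c : euler ws f c -> euler ws (fun x => a * f x) (a * c).
Proof.
elim: ws f => [|w ws IH] f /=; first by move=> h x; rewrite h.
move=> [g fg gc]; exists (fun x => a * g x); last exact: IH.
by move=> x; apply: euler1Z.
Qed.

Lemma euler_ext ws f f' c : f =1 f' -> euler ws f c -> euler ws f' c.
Proof. by move=> /funext->. Qed.

Lemma euler0 ws : euler ws (fun=> 0) 0.
Proof.
elim: ws => [|w ws IH] //=; exists (fun=> 0) => // x.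
exact: euler1_0.
Qed.

Lemma euler_sum ws (I : Type) (r : seq I) (P : pred I) (a c : I -> int)
    (F : I -> V -> int) : (forall i, P i -> euler ws (F i) (c i)) ->
  euler ws (fun x => \sum_(i <- r | P i) a i * F i x) (\sum_(i <- r | P i) a i * c i).
Proof.
move=> h; elim: r => [|i r IH].
  by rewrite big_nil; apply: euler_ext (euler0 ws) => x; rewrite big_nil.
rewrite big_cons; case: (boolP (P i)) => Pi; last first.
  by apply: euler_ext IH => x; rewrite big_cons (negbTE Pi).
apply: euler_ext (eulerD (eulerZ (a i) (h i Pi)) IH) => x.
by rewrite big_cons Pi.
Qed.

(** The cylinder over the projection of [A] along [w]; staying in the same space spares a change of
    dimension at each projection. *)
Definition saturate (w : V) A : set V := [set x | exists t : R, A (x + t *: w)].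

Definition cvx A := forall x y (t : R), A x -> A y -> 0 <= t <= 1 ->
  A (x + t *: (y - x)).

(** Openness is required along each line only: one-dimensional integration uses no more, and [V]
    needs no topology. *)
Definition rel_open O U := [/\ cvx O, forall x y, O x -> O y -> x - y \in U &
  forall x w, O x -> w \in U ->
    exists2 e : R, 0 < e & forall t, `|t| < e -> O (x + t *: w)].

Lemma cvx_line A x w : cvx A -> interval1 [set t : R | A (x + t *: w)].
Proof.
move=> cA a b t /= Aa Ab /andP[at_ tb].
have [ab|ab] := eqVneq a b.
  by rewrite (_ : t = a)//; apply/le_anti; rewrite at_ ab tb.
have ab0 : 0 < b - a by rewrite subr_gt0 lt_neqAle ab (le_trans at_).
have := cA _ _ ((t - a) / (b - a)) Aa Ab.
rewrite opprD addrACA subrr add0r -scalerBl scalerA divfK ?gt_eqF//.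
rewrite -addrA -scalerDl subrKC; apply.
rewrite divr_ge0 ?subr_ge0 ?(ltW ab0)//=; last by move: ab0; rewrite subr_gt0 => /ltW.
by rewrite ler_pdivrMr// mul1r lerB.
Qed.

(** A line that meets [O] does so in an open interval, of characteristic -1, if [w] is a direction
    of [O], and in a single point otherwise. *)
Lemma rel_open_line O U w : rel_open O U -> line_integral w (fun x => ind (O x))
  (fun x => (if w \in U then -1 else 1) * ind (saturate w O x)).
Proof.
move=> [cO dO oO] x.
have [sx|nsx] := pselect (saturate w O x); last first.
  rewrite (indF nsx) mulr0; apply: euler1_ext euler1_0 => t.
  by rewrite indF// => Ot; apply: nsx; exists t.
rewrite (indT sx) mulr1; case: ifPn => wU.
  apply: (@euler1_open _ [set t | O (x + t *: w)]) => //; first exact: cvx_line.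
  move=> t Ot; have [e e0 He] := oO _ _ Ot wU; exists e => // s /andP[s1 s2].
  have := He (s - t); rewrite -addrA -scalerDl subrKC; apply.
  by rewrite ltr_norml; lra.
have [t Ot] := sx.
apply: euler1_ext (euler1_itv (lexx t)) => s; apply: ind_ext; split.
  by move=> /le_anti<-.
move=> Os; have := dO _ _ Os Ot.
rewrite opprD addrACA subrr add0r -scalerBl => stU.
suff -> : s = t by rewrite lexx.
apply/eqP; rewrite -subr_eq0; apply: contraNT wU => st0.
by rewrite -(scalerK st0 w) memvZ.
Qed.

Lemma saturate_cvx w A : cvx A -> cvx (saturate w A).
Proof.
move=> cA x y t [a Aa] [b Ab] t01; exists (a + t * (b - a)).
suff -> : x + t *: (y - x) + (a + t * (b - a)) *: w =
  (x + a *: w) + t *: ((y + b *: w) - (x + a *: w)) by exact: cA.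
rewrite opprD addrACA -scalerBl [t *: (y - x + _)]scalerDr scalerA.
by rewrite addrACA -scalerDl.
Qed.

Lemma rel_open_saturate O U w :
  rel_open O U -> rel_open (saturate w O) (U + <[w]>)%VS.
Proof.
move=> [cO dO oO]; split; first exact: saturate_cvx.
  move=> x y [a Oa] [b Ob].
  have -> : x - y = ((x + a *: w) - (y + b *: w)) + (b - a) *: w.
    by rewrite opprD addrACA -scalerBl -(opprB a b) scaleNr addrK.
  by apply: memv_add; [exact: dO|rewrite memvZ ?memv_line].
move=> x v [a Oa] /memv_addP[u uU [_ /vlineP[k ->] ->]].
have [e e0 He] := oO _ _ Oa uU; exists e => // t /He Ot.
exists (a - t * k).
suff -> : x + t *: (u + k *: w) + (a - t * k) *: w = x + a *: w + t *: u by [].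
by rewrite scalerDr scalerA scalerBl -!addrA subrKC [X in x + X]addrC.
Qed.

(** [S] collects the directions already integrated. Integrating along [w] in [U] costs a sign; along
    [w] outside [U] it costs none but raises the dimension of [U]. Either way the parity of the
    exponent is right, and it ends at twice the dimension of the space. *)
Lemma euler_rel_open ws O U S : rel_open O U -> O !=set0 ->
  (forall x v, O x -> v \in S -> O (x + v)) -> (S + <<ws>> = fullv)%VS ->
  euler ws (fun x => ind (O x)) ((-1) ^+ (size ws + \dim U + \dim {:V})).
Proof.
elim: ws O U S => [|w ws IH] O U S hO [o Oo] hS.
  rewrite span_nil addv0 => S1 /= x.
  have OT y : O y by rewrite -(subrKC o y); apply: hS => //; rewrite S1 memvf.
  rewrite (_ : U = fullv) ?indT//; last first.
    apply/eqP; rewrite eqEsubv subvf; apply/subvP => v _.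
    by case: hO => _ dO _; rewrite -(subr0 v); apply: dO.
  by rewrite add0n addnn -mul2n exprM sqrrN !expr1n.
move=> S1 /=.
exists (fun x => (if w \in U then -1 else 1) * ind (saturate w O x)).
  exact: rel_open_line.
have sO : saturate w O !=set0 by exists o; exists 0; rewrite scale0r addr0.
have := IH _ _ (S + <[w]>)%VS (rel_open_saturate w hO) sO.
rewrite -addvA -span_cons => /(_ _ S1) h.
have {}h : euler ws (fun x => ind (saturate w O x))
    ((-1) ^+ (size ws + \dim (U + <[w]>) + \dim {:V})).
  apply: h => x v [a Oa] /memv_addP[s sS [_ /vlineP[k ->] ->]].
  exists (a - k).
  suff -> : x + (s + k *: w) + (a - k) *: w = x + a *: w + s by exact: hS.
  by rewrite scalerBl -!addrA subrKC [X in x + X]addrC.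
move: (eulerZ (if w \in U then -1 else 1) h).
case: ifPn => wU.
  by rewrite (addv_idPl _) -?memvE// addSn exprS.
rewrite mul1r dimv_disjoint_sum ?dim_vline; last first.
  apply/eqP; rewrite -subv0; apply/subvP => v; rewrite memv_cap.
  move=> /andP[vU /vlineP[k vE]]; rewrite memv0; move: vU; rewrite vE.
  have [->|k0] := eqVneq k 0; first by rewrite scale0r.
  by move=> /(memvZ k^-1); rewrite scalerK// (negbTE wU).
rewrite (_ : w != 0); last by apply: contraNneq wU => ->; exact: mem0v.
by rewrite addn1 addnS.
Qed.

End EulerIterated.

(** * Polyhedra and Fourier-Motzkin elimination *)

Section Dot.
Context {R : realType} {n : nat}.
Implicit Types (x y : 'rV[R]_n) (u v : 'cV[R]_n).

Definition dot x u : R := (x *m u) 0 0.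

Lemma dotDl x y u : dot (x + y) u = dot x u + dot y u.
Proof. by rewrite /dot mulmxDl mxE. Qed.
Lemma dotZl a x u : dot (a *: x) u = a * dot x u.
Proof. by rewrite /dot -scalemxAl mxE. Qed.
Lemma dotNl x u : dot (- x) u = - dot x u.
Proof. by rewrite /dot mulNmx mxE. Qed.
Lemma dotBl x y u : dot (x - y) u = dot x u - dot y u.
Proof. by rewrite dotDl dotNl. Qed.
Lemma dot0l u : dot 0 u = 0.
Proof. by rewrite /dot mul0mx mxE. Qed.
Lemma dotDr x u v : dot x (u + v) = dot x u + dot x v.
Proof. by rewrite /dot mulmxDr mxE. Qed.
Lemma dotZr a x u : dot x (a *: u) = a * dot x u.
Proof. by rewrite /dot -scalemxAr mxE. Qed.
Lemma dotNr x u : dot x (- u) = - dot x u.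
Proof. by rewrite /dot mulmxN mxE. Qed.
Lemma dot_sumr (I : Type) (r : seq I) (P : pred I) x (F : I -> 'cV[R]_n) :
  dot x (\sum_(i <- r | P i) F i) = \sum_(i <- r | P i) dot x (F i).
Proof. by rewrite /dot mulmx_sumr summxE. Qed.
Lemma dot_delta x j : dot x (delta_mx j 0) = x 0 j.
Proof. by rewrite /dot -colE mxE. Qed.

End Dot.

Section Polyhedra.
Context {R : realType}.

Definition halfspaces n (s : seq ('cV[R]_n * R)) : set 'rV[R]_n :=
  [set x | forall p, p \in s -> dot x p.1 <= p.2].

Definition polyhedron n (A : set 'rV[R]_n) := exists s, A = halfspaces s.

Definition bounded n (A : set 'rV[R]_n) :=
  exists M, forall x, A x -> forall j, `|x 0 j| <= M.

Lemma polyhedronI n (A B : set 'rV[R]_n) :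
  polyhedron A -> polyhedron B -> polyhedron (A `&` B).
Proof.
move=> [s ->] [s' ->]; exists (s ++ s'); apply/seteqP; split => x /=.
  by move=> [h h'] p; rewrite mem_cat => /orP[/h|/h'].
by move=> h; split => p ps; apply: h; rewrite mem_cat ps ?orbT.
Qed.

Lemma polyhedron_halfspace n (u : 'cV[R]_n) c : polyhedron [set x | dot x u <= c].
Proof.
exists [:: (u, c)]; apply/seteqP; split => x /= => [h p|h].
  by rewrite inE => /eqP->.
by apply: (h (u, c)); rewrite inE.
Qed.

Lemma polyhedron_forall n (I : finType) (A : I -> set 'rV[R]_n) :
  (forall i, polyhedron (A i)) -> polyhedron [set x | forall i, A i x].
Proof.
move=> hA; suff h (r : seq I) : polyhedron [set x | forall i, i \in r -> A i x].
  have := h (enum I); congr polyhedron; apply/seteqP; split => x /= Ax i.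
    by apply: Ax; rewrite mem_enum.
  by move=> _; exact: Ax.
elim: r => [|i r IH].
  by exists [::]; apply/seteqP; split => x.
have := polyhedronI (hA i) IH; congr polyhedron; apply/seteqP; split => x /=.
  by move=> [Ai Ar] j; rewrite inE => /orP[/eqP->|/Ar].
by move=> Ax; split => [|j jr]; apply: Ax; rewrite inE ?eqxx ?jr ?orbT.
Qed.

Lemma polyhedron_preim m n (M : 'M[R]_(m, n)) b (A : set 'rV[R]_n) :
  polyhedron A -> polyhedron [set x | A (b + x *m M)].
Proof.
move=> [s ->]; exists [seq (M *m p.1, p.2 - dot b p.1) | p <- s].
apply/seteqP; split => x /= => [h _ /mapP[p ps ->]|h p ps] /=.
  by rewrite lerBrDl /dot mulmxA; have := h p ps; rewrite dotDl.
have := h _ (map_f _ ps); rewrite /= lerBrDl dotDl /dot mulmxA; exact.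
Qed.

Lemma polyhedron_le n j (c : R) : polyhedron [set x : 'rV[R]_n | x 0 j <= c].
Proof.
have := polyhedron_halfspace (delta_mx j 0) c; congr polyhedron.
by apply/seteqP; split => x /=; rewrite dot_delta.
Qed.

Lemma polyhedron_ge n j (c : R) : polyhedron [set x : 'rV[R]_n | c <= x 0 j].
Proof.
have := polyhedron_halfspace (- delta_mx j 0) (- c); congr polyhedron.
by apply/seteqP; split => x /=; rewrite dotNr dot_delta lerN2.
Qed.

Lemma polyhedron_point n (y : 'rV[R]_n) : polyhedron [set x | x = y].
Proof.
have := polyhedron_forall (fun j : 'I_n =>
  polyhedronI (polyhedron_le j (y 0 j)) (polyhedron_ge j (y 0 j))).
congr polyhedron; apply/seteqP; split => x /=.
  by move=> h; apply/rowP => j; apply/le_anti/andP; split; case: (h j).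
by move=> -> j.
Qed.

Lemma between (L U : seq R) : (forall l u, l \in L -> u \in U -> l <= u) ->
  exists t, (forall l, l \in L -> l <= t) /\ (forall u, u \in U -> t <= u).
Proof.
elim: L => [_|l L IH h].
  elim: U => [|u U [t [_ h]]]; first by exists 0.
  exists (Num.min u t); split => // v; rewrite inE ge_min => /orP[/eqP->|/h->].
    by rewrite lexx.
  by rewrite orbT.
have [|t [tL tU]] := IH.
  by move=> k u kL uU; apply: h; rewrite // inE kL orbT.
exists (Num.max l t); split => [k|u uU].
  by rewrite inE le_max => /orP[/eqP->|/tL->]; rewrite ?lexx ?orbT.
by rewrite ge_max tU// h// inE eqxx.
Qed.

(* Fourier-Motzkin elimination of the parameter of the line. *)
Lemma polyhedron_saturate n (w : 'rV[R]_n) A :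
  polyhedron A -> polyhedron (saturate w A).
Proof.
move=> [s ->]; pose d p := dot w (p : 'cV[R]_n * R).1.
(* With [d p] positive and [d q] negative, the coefficients [d p] and [- d q] are positive and the
   combined normal is orthogonal to [w]. *)
pose comb (p q : 'cV[R]_n * R) := (d p *: q.1 - d q *: p.1, d p * q.2 - d q * p.2).
exists ([seq p <- s | d p == 0] ++
  [seq comb p q | p <- [seq p <- s | 0 < d p], q <- [seq q <- s | d q < 0]]).
apply/seteqP; split => x /=.
  move=> [t h] p; rewrite mem_cat mem_filter => /orP[/andP[/eqP d0 ps]|].
    by have := h p ps; rewrite dotDl dotZl -/(d p) d0 mulr0 addr0.
  move=> /allpairsP[[q r] /= [+ + ->]].
  rewrite !mem_filter => /andP[dq /h hq] /andP[dr /h hr].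
  move: hq hr; rewrite /= dotDr dotNr !dotZr !dotDl !dotZl -/(d q) -/(d r).
  by nra.
move=> h.
pose bnd p := (p.2 - dot x p.1) / d p.
have [|t [tL tU]] := @between [seq bnd p | p <- s & d p < 0]
    [seq bnd p | p <- s & 0 < d p].
  move=> _ _ /mapP[q + ->] /mapP[p + ->].
  rewrite !mem_filter => /andP[dq qs] /andP[dp ps].
  have := h (comb p q).
  rewrite mem_cat allpairs_f ?orbT ?mem_filter ?dp ?dq// => /(_ isT) /=.
  rewrite dotDr dotNr !dotZr /bnd => hc.
  rewrite ler_ndivrMr// mulrAC ler_pdivrMr//; nra.
exists t => p ps; rewrite dotDl dotZl -/(d p) -lerBrDl.
have [d0|d0|d0] := ltgtP (d p) 0.
- by rewrite -ler_ndivrMr//; apply/tL/map_f; rewrite mem_filter d0.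
- by rewrite -ler_pdivlMr//; apply/tU/map_f; rewrite mem_filter d0.
- by rewrite d0 mulr0 subr_ge0; apply: h; rewrite mem_cat mem_filter d0 eqxx ps.
Qed.

(** The coordinates of [x] are eliminated one at a time; [r] lists those already free, the others
    being held at 0. *)
Lemma polyhedron_proj m n (B : set 'rV[R]_(m + n)) :
  polyhedron B -> polyhedron [set y | exists x, B (row_mx x y)].
Proof.
move=> hB.
suff h (r : seq 'I_m) : polyhedron [set z | exists x : 'rV[R]_m,
    (forall j, j \notin r -> x 0 j = 0) /\ B (z + row_mx x 0)].
  have := polyhedron_preim (row_mx 0 1%:M) 0 (h (enum 'I_m)).
  congr polyhedron; apply/seteqP; split => y /= [x].
    move=> [_]; rewrite add0r mul_mx_row mulmx0 mulmx1 add_row_mx add0r addr0.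
    by exists x.
  move=> Bx; exists x; split => [j|]; first by rewrite mem_enum.
  by rewrite add0r mul_mx_row mulmx0 mulmx1 add_row_mx add0r addr0.
elim: r => [|j r IH].
  have := hB; congr polyhedron; apply/seteqP; split => z /=.
    by move=> Bz; exists 0; split => [j|]; rewrite ?mxE// row_mx0 addr0.
  move=> [x [x0]]; suff -> : x = 0 by rewrite row_mx0 addr0.
  by apply/rowP => j; rewrite x0// mxE.
have := polyhedron_saturate (row_mx (delta_mx 0 j) 0) IH.
congr polyhedron; apply/seteqP; split => z /=.
  move=> [t [x [x0 Bx]]]; exists (t *: delta_mx 0 j + x); split.
    move=> k; rewrite inE negb_or => /andP[kj kr].
    by rewrite !mxE x0// (negbTE kj) andbF mulr0 addr0.
  by move: Bx; rewrite -addrA scale_row_mx scaler0 add_row_mx addr0.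
move=> [x [x0 Bx]]; exists (x 0 j), (x - x 0 j *: delta_mx 0 j); split.
  move=> k kr; rewrite !mxE eqxx/=; have [->|kj] := eqVneq k j.
    by rewrite mulr1 subrr.
  by rewrite mulr0 subr0 x0// inE negb_or kj.
by rewrite -addrA scale_row_mx scaler0 add_row_mx addr0 subrKC.
Qed.

(** The image is the projection of the graph of the linear map over [A]. *)
Lemma polyhedron_image m n (M : 'M[R]_(m, n)) (A : set 'rV[R]_m) :
  polyhedron A -> polyhedron [set x *m M | x in A].
Proof.
move=> hA.
have := polyhedron_proj (polyhedronI (polyhedron_preim (col_mx 1%:M 0) 0 hA)
  (polyhedron_preim (col_mx M (- 1%:M)) 0 (polyhedron_point 0))).
congr polyhedron; apply/seteqP; split => y /=.
  move=> [x]; rewrite !add0r !mul_row_col mulmx1 mulmx0 addr0 mulmxN mulmx1.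
  by move=> [Ax /subr0_eq<-]; exists x.
move=> [x Ax <-]; exists x.
by rewrite !add0r !mul_row_col mulmx1 mulmx0 addr0 mulmxN mulmx1 subrr.
Qed.

Lemma polyhedron_sum n (A B : set 'rV[R]_n) :
  polyhedron A -> polyhedron B -> polyhedron (minkowski_sum A B).
Proof.
move=> hA hB.
have := polyhedron_proj (polyhedronI (polyhedron_preim (col_mx 1%:M 0) 0 hA)
  (polyhedron_preim (col_mx (- 1%:M) 1%:M) 0 hB)).
congr polyhedron; apply/seteqP; split => y /=.
  move=> [x]; rewrite !add0r !mul_row_col !mulmx1 mulmx0 addr0 mulmxN mulmx1.
  move=> [Ax Bx]; exists x => //; exists (- x + y) => //.
  by rewrite addrA subrr add0r.
move=> [x Ax [z Bz <-]]; exists x.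
by rewrite !add0r !mul_row_col !mulmx1 mulmx0 addr0 mulmxN mulmx1 addKr.
Qed.

Lemma polyhedron_opp n (A : set 'rV[R]_n) : polyhedron A -> polyhedron [set x | A (- x)].
Proof.
move=> hA; have := polyhedron_preim (- 1%:M) 0 hA; congr polyhedron.
by apply/seteqP; split => x /=; rewrite mulmxN mulmx1 add0r.
Qed.

Lemma polyhedron_translate n (A : set 'rV[R]_n) b :
  polyhedron A -> polyhedron [set x | A (b + x)].
Proof.
move=> hA; have := polyhedron_preim 1%:M b hA; congr polyhedron.
by apply/seteqP; split => x /=; rewrite mulmx1.
Qed.

Lemma polyhedron_cvx n (A : set 'rV[R]_n) : polyhedron A -> cvx A.
Proof.
move=> [s ->] x y t hx hy /andP[t0 t1] p ps.
by rewrite dotDl dotZl dotBl; have := hx p ps; have := hy p ps; nra.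
Qed.

(** Takes the place of a compactness argument: going down from [t0], an inequality either stays
    satisfied or becomes a lower bound on [t], and finitely many lower bounds have a maximum, which
    is attained. *)
Lemma polyhedron_line_min n (A : set 'rV[R]_n) x w t0 : polyhedron A ->
  A (x + t0 *: w) -> (forall t, t <= t0 -> A (x + t *: w)) \/
  exists2 a, a <= t0 & forall t, t <= t0 -> A (x + t *: w) <-> a <= t.
Proof.
move=> [s ->]; elim: s => [|p s IH] h0; first by left.
have hs : halfspaces s (x + t0 *: w).
  by move=> q qs; apply: h0; rewrite inE qs orbT.
have hp : dot x p.1 + t0 * dot w p.1 <= p.2.
  by rewrite -dotZl -dotDl; apply: h0; rewrite inE eqxx.
have cons t : halfspaces (p :: s) (x + t *: w) <->
    dot x p.1 + t * dot w p.1 <= p.2 /\ halfspaces s (x + t *: w).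
  split=> [h|[h hs'] q].
    rewrite -dotZl -dotDl; split; first by apply: h; rewrite inE eqxx.
    by move=> q qs; apply: h; rewrite inE qs orbT.
  by rewrite inE => /orP[/eqP->|/hs'//]; rewrite dotDl dotZl.
have [d0|d0] := leP 0 (dot w p.1).
  have hp' t : t <= t0 -> dot x p.1 + t * dot w p.1 <= p.2 by nra.
  case: (IH hs) => [h|[a a0 h]]; [left|right; exists a => //] => t tt0.
    by apply/cons; split; [exact: hp'|exact: h].
  by rewrite cons h//; split=> [[]|?] //; split => //; exact: hp'.
pose q := (p.2 - dot x p.1) / dot w p.1.
have hq t : dot x p.1 + t * dot w p.1 <= p.2 <-> q <= t.
  by rewrite /q ler_ndivrMr// lerBrDl.
case: (IH hs) => [h|[a a0 h]]; right.
  exists q; first by apply/hq.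
  by move=> t tt0; rewrite cons hq; split=> [[]|?] //; split => //; exact: h.
exists (Num.max q a); first by rewrite ge_max a0 andbT; apply/hq.
move=> t tt0; rewrite cons hq h// ge_max; split=> [[-> ->]|/andP[]] //.
Qed.

End Polyhedra.

(** * Euler characteristic of bounded polyhedra *)

Section PolytopeEuler.
Context {R : realType} {n : nat}.
Implicit Types (A : set 'rV[R]_n) (w : 'rV[R]_n).

Lemma boundedS A B : A `<=` B -> bounded B -> bounded A.
Proof. by move=> AB [M hM]; exists M => x /AB /hM. Qed.

Lemma polyhedron_line_itv A x w t0 M : polyhedron A -> A (x + t0 *: w) ->
  (forall t, A (x + t *: w) -> `|t| <= M) ->
  exists a b, forall t, A (x + t *: w) <-> a <= t <= b.
Proof.
move=> hA At0 hM.
have := hM _ At0; rewrite ler_norml => /andP[Mt0 t0M].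
have [h|[a a0 ha]] := polyhedron_line_min hA At0.
  exfalso; have /hM : A (x + (- M - 1) *: w) by apply: h; lra.
  by rewrite ler_norml; lra.
have At0' : A (x + (- t0) *: (- w)) by rewrite scaleNr scalerN opprK.
have [h|[b b0 hb]] := polyhedron_line_min hA At0'.
  exfalso; have /hM : A (x + (M + 1) *: w).
    by rewrite -[_ *: w]opprK -scalerN -scaleNr; apply: h; lra.
  by rewrite ler_norml; lra.
exists a, (- b) => t; have [tt0|tt0] := leP t t0.
  by rewrite ha//; split => [?|/andP[]//]; lra.
rewrite -[t *: w]opprK -scalerN -scaleNr hb; last by lra.
by split => [?|/andP[_ ?]]; [apply/andP; split; lra|lra].
Qed.

Lemma polyhedron_line_integral A w : polyhedron A ->
  (forall x, exists M, forall t, A (x + t *: w) -> `|t| <= M) ->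
  line_integral w (fun x => ind (A x)) (fun x => ind (saturate w A x)).
Proof.
move=> hA bA x.
have [[t0 At0]|ns] := pselect (saturate w A x); last first.
  rewrite (indF ns); apply: euler1_ext euler1_0 => t.
  by rewrite indF// => At; apply: ns; exists t.
rewrite indT; last by exists t0.
have [M hM] := bA x.
have [a [b hab]] := polyhedron_line_itv hA At0 hM.
have /andP[at0 t0b] := (hab t0).1 At0.
apply: euler1_ext (euler1_itv (le_trans at0 t0b)) => t.
by apply: ind_ext; rewrite hab.
Qed.

Lemma bounded_coord_line A w j (M : R) : w 0 j != 0 ->
  (forall x, A x -> `|x 0 j| <= M) ->
  forall x, exists M', forall t, A (x + t *: w) -> `|t| <= M'.
Proof.
move=> wj hM x; exists ((M + `|x 0 j|) / `|w 0 j|) => t /hM.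
rewrite !mxE => h; rewrite ler_pdivlMr ?normr_gt0// -normrM.
rewrite -[t * _](addKr (x 0 j)) (le_trans (ler_normD _ _))// normrN addrC.
by rewrite lerD2r.
Qed.

Definition std_basis : seq 'rV[R]_n := [seq delta_mx 0 j | j <- enum 'I_n].

Lemma std_basis_full : (<<std_basis>> = fullv)%VS.
Proof.
apply/eqP; rewrite eqEsubv subvf; apply/subvP => x _.
rewrite [x]row_sum_delta; apply: memv_suml => j _; apply: memvZ.
by apply: memv_span; apply: map_f; rewrite mem_enum.
Qed.

Lemma size_std_basis : size std_basis = \dim {:'rV[R]_n}.
Proof. by rewrite size_map -cardE card_ord dimvf /dim /= mul1n. Qed.

(** Each line meets [A] in a closed segment or not at all, so integration replaces the indicator of
    [A] by that of its cylinder, again a polyhedron. *)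
Lemma euler_polytope A : polyhedron A -> bounded A ->
  euler std_basis (fun x => ind (A x)) (ind (A !=set0)).
Proof.
move=> hA bA; have [[y Ay]|nA] := pselect (A !=set0); last first.
  rewrite indF//; apply: euler_ext (euler0 _) => x.
  by rewrite indF// => Ax; apply: nA; exists x.
rewrite indT; last by exists y.
(* Cylinders are unbounded, so the induction asks for bounds only in the coordinates still to be
   integrated, and for invariance along the others. *)
have : forall j, j \in enum 'I_n -> exists M, forall x, A x -> `|x 0 j| <= M.
  by move=> j _; case: bA => M hM; exists M => x /hM.
have : forall j x t, j \notin enum 'I_n -> A x -> A (x + t *: delta_mx 0 j).
  by move=> j x t; rewrite mem_enum.
rewrite /std_basis; have := enum_uniq 'I_n; move: (enum 'I_n) => r.
elim: r A hA y Ay {bA} => [|j r IH] A hA y Ay /=.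
  move=> _ sA _ x; rewrite indT// -(subrKC y x) [x - y]row_sum_delta.
  by elim/big_rec: _ => [|i z _ Az]; rewrite ?addr0// addrCA addrC; exact: sA.
move=> /andP[jr ur] sA bA.
exists (fun x => ind (saturate (delta_mx 0 j) A x)).
  have [|M hM] := bA j; first by rewrite inE eqxx.
  apply: polyhedron_line_integral => //.
  by apply: (bounded_coord_line _ hM); rewrite mxE !eqxx oner_eq0.
apply: (IH _ _ y) => //.
- exact: polyhedron_saturate.
- by exists 0; rewrite scale0r addr0.
- move=> i x t ir [a Aa]; have [->|ij] := eqVneq i j.
    by exists (a - t); rewrite -addrA -scalerDl subrKC.
  by exists a; rewrite addrAC; apply: sA => //; rewrite inE negb_or ij.
- move=> i ir; have [|M hM] := bA i; first by rewrite inE ir orbT.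
  exists M => x [a /hM]; rewrite !mxE eqxx/=.
  have -> : (i == j) = false by apply: contraNF jr => /eqP<-.
  by rewrite mulr0 addr0.
Qed.

(** Both sides are the Euler characteristic of the same function, which is linear and equals 1 on
    nonempty polytopes. *)
Lemma euler_relation (I : Type) (r : seq I) (P : pred I) (a : I -> int)
    (A : I -> set 'rV[R]_n) (B : set 'rV[R]_n) :
  (forall i, P i -> polyhedron (A i) /\ bounded (A i)) ->
  polyhedron B -> bounded B ->
  (forall x, \sum_(i <- r | P i) a i * ind (A i x) = ind (B x)) ->
  \sum_(i <- r | P i) a i * ind (A i !=set0) = ind (B !=set0).
Proof.
move=> hA hB bB h; apply: euler_unique (euler_polytope hB bB).
apply: euler_ext (euler_sum (F := fun i x => ind (A i x)) r a _) => [x|i Pi].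
  by rewrite h.
by apply: euler_polytope; apply hA.
Qed.

Lemma polyhedron_set0 : polyhedron (set0 : set 'rV[R]_n).
Proof.
exists [:: (0, - 1)]; apply/seteqP; split => x // /(_ (0, -1)).
by rewrite inE eqxx /dot mulmx0 mxE oppr_ge0 leNgt ltr01 => /(_ isT).
Qed.

Lemma bounded_set0 : bounded (set0 : set 'rV[R]_n).
Proof. by exists 0. Qed.

End PolytopeEuler.

(** * Faces of a polyhedron *)

Section EulerBasis.
Context {R : realType} {V : vectType R}.

Lemma euler_rel_open_basis (ws : seq V) (O : set V) U : rel_open O U ->
  O !=set0 -> (<<ws>> = fullv)%VS -> size ws = \dim {:V} ->
  euler ws (fun x => ind (O x)) ((-1) ^+ \dim U).
Proof.
move=> hO O0 ws1 sws; have := euler_rel_open (ws := ws) (S := 0%VS) hO O0.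
rewrite add0v ws1 => /(_ _ erefl); rewrite addnAC sws addnn -mul2n exprD.
rewrite exprM sqrrN !expr1n mul1r; apply=> x v Ox.
by rewrite memv0 => /eqP->; rewrite addr0.
Qed.

End EulerBasis.

Lemma small_forall (R : realType) (I : finType) (p : I -> R -> Prop) :
  (forall i, exists2 e, 0 < e & forall t, `|t| < e -> p i t) ->
  exists2 e, 0 < e & forall t, `|t| < e -> forall i, p i t.
Proof.
move=> h; suff [e e0 He] : exists2 e, 0 < e &
    forall t, `|t| < e -> forall i, i \in enum I -> p i t.
  by exists e => // t te i; apply: He => //; rewrite mem_enum.
elim: (enum I) => [|i r [e e0 He]]; first by exists 1.
have [e' e'0 He'] := h i; exists (Num.min e e'); first by rewrite lt_min e0.
move=> t; rewrite lt_min => /andP[te te'] j; rewrite inE => /orP[/eqP->|].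
  exact: He'.
exact: He.
Qed.

Lemma small_lt (R : realType) (a b c : R) : a < c ->
  exists2 e, 0 < e & forall t, `|t| < e -> a + t * b < c.
Proof.
move=> ac; have b0 : 0 < 1 + `|b| by rewrite ltr_pwDl.
exists ((c - a) / (1 + `|b|)) => [|t]; first by rewrite divr_gt0 ?subr_gt0.
rewrite ltr_pdivlMr// => h; rewrite -ltrBrDl; apply: le_lt_trans h.
rewrite (le_trans (ler_norm _))// normrM; apply: ler_wpM2l => //.
by rewrite lerDr.
Qed.

Section Faces.
Context {R : realType} {d k : nat}.
Variable (u : 'I_k -> 'cV[R]_d).
Implicit Types (c : 'I_k -> R) (I J : {set 'I_k}) (x y z w : 'rV[R]_d).

(** The normals [u] are fixed while [c] varies, because translates and tangent cones only change the
    right-hand sides. *)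
Definition solutions c : set 'rV[R]_d := [set x | forall i, dot x (u i) <= c i].

Definition tight c x : {set 'I_k} := [set i | dot x (u i) == c i].

Definition tight_face c J : set 'rV[R]_d :=
  [set x | solutions c x /\ J \subset tight c x].

(** With all indices in [I] this is the relative interior of a face of the polyhedron; with [I] the
    set tight at [z] and [c = 0], that of a face of the tangent cone at [z]. *)
Definition stratum c I J : set 'rV[R]_d := [set x | forall i, i \in I ->
  if i \in J then dot x (u i) = c i else dot x (u i) < c i].

(** Only sets that are exactly the tight set of some point are kept, so each nonempty face has a
    single index, and [annihilator] is its direction. *)
Definition face_index c J : bool := `[< stratum c finset.setT J !=set0 >].

Definition annihilator J : {vspace 'rV[R]_d} :=
  (\bigcap_(i in J) lker (linfun (mulmxr (u i))))%VS.

Definition face_sign J : int := (-1) ^+ \dim (annihilator J).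

Lemma annihilatorP J w :
  reflect (forall i, i \in J -> dot w (u i) = 0) (w \in annihilator J).
Proof.
apply: (iffP idP) => [|h].
  rewrite memvE => /subv_bigcapP h i iJ; move: (h i iJ).
  by rewrite -memvE memv_ker lfunE /= /dot => /eqP->; rewrite mxE.
rewrite memvE; apply/subv_bigcapP => i iJ; rewrite -memvE memv_ker lfunE /=.
by apply/eqP/rowP => j; rewrite !ord1 [RHS]mxE; exact: h.
Qed.

Lemma solutionsE c : solutions c =
  halfspaces [seq (u i, c i) | i <- enum 'I_k].
Proof.
apply/seteqP; split => x /= h; first by move=> _ /mapP[i _ ->]; exact: h.
by move=> i; apply: (h (u i, c i)); apply: map_f; rewrite mem_enum.
Qed.

Lemma polyhedron_solutions c : polyhedron (solutions c).
Proof. by eexists; exact: solutionsE. Qed.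

Lemma tightP c x i : reflect (dot x (u i) = c i) (i \in tight c x).
Proof. by rewrite inE; exact: eqP. Qed.

Lemma polyhedron_tight_face c J : polyhedron (tight_face c J).
Proof.
have -> : tight_face c J = solutions c `&`
    [set x | forall i, (i \in J -> dot x (u i) = c i)].
  apply/seteqP; split => x /= [hx b]; split => //.
    by move=> i /(fintype.subsetP b) /tightP.
  by apply/fintype.subsetP => i /b /tightP.
apply: polyhedronI; first exact: polyhedron_solutions.
apply: polyhedron_forall => i; have [iJ|iJ] := boolP (i \in J); last first.
  by exists [::]; apply/seteqP; split.
have := polyhedronI (polyhedron_halfspace (u i) (c i))
  (polyhedron_halfspace (- u i) (- c i)); congr polyhedron.
apply/seteqP; split => x /=; rewrite dotNr lerN2.
  by move=> [h1 h2] _; apply/le_anti; rewrite h1.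
by move=> ->.
Qed.

Lemma stratum_rel_open c I J : J \subset I -> rel_open (stratum c I J) (annihilator J).
Proof.
move=> /fintype.subsetP JI; split.
- move=> x y t hx hy /andP[t0 t1] i iI; rewrite dotDl dotZl dotBl.
  move: (hx i iI) (hy i iI); case: ifP => _ ex ey.
    by rewrite ex ey subrr mulr0 addr0.
  have [->|tn0] := eqVneq t 0; first by rewrite mul0r addr0.
  by have {tn0} t_gt0 : 0 < t; [rewrite lt_neqAle eq_sym tn0|nra].
- move=> x y hx hy; apply/annihilatorP => i iJ; rewrite dotBl.
  by move: (hx i (JI _ iJ)) (hy i (JI _ iJ)); rewrite iJ => -> ->; rewrite subrr.
- move=> x w hx /annihilatorP hw.
  have [i|e e0 He] := @small_forall R 'I_k (fun i t => i \in I ->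
      if i \in J then dot (x + t *: w) (u i) = c i
      else dot (x + t *: w) (u i) < c i).
    have [iI|iI] := boolP (i \in I); last by exists 1.
    have := hx i iI; case: ifP => iJ h.
      by exists 1 => // t _ _; rewrite dotDl dotZl hw// mulr0 addr0.
    have [e e0 He] := small_lt (dot w (u i)) h; exists e => // t te _.
    by rewrite dotDl dotZl; exact: He.
  by exists e => // t te i; exact: He.
Qed.

Lemma stratumT c J x : stratum c finset.setT J x <-> solutions c x /\ tight c x = J.
Proof.
split=> [h|[hx <-] i _].
  split=> [i|]; first by have := h i (finset.in_setT i); case: ifP => _ => [->|/ltW].
  apply/setP => i; rewrite inE; have := h i (finset.in_setT i); case: ifP => _ => [->|].
    by rewrite eqxx.
  by move=> /lt_eqF.
by case: ifPn => [/tightP//|]; rewrite inE lt_neqAle hx andbT.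
Qed.

Lemma face_index_tight c x : solutions c x -> face_index c (tight c x).
Proof. by move=> hx; apply/asboolP; exists x; apply/stratumT. Qed.

Lemma face_indexP c J : face_index c J ->
  exists2 x, solutions c x & tight c x = J.
Proof. by move=> /asboolP[x /stratumT[]]; exists x. Qed.

Lemma tight_midpoint c x y : solutions c x -> solutions c y ->
  solutions c (2^-1 *: (x + y)) /\
  tight c (2^-1 *: (x + y)) = tight c x :&: tight c y.
Proof.
move=> hx hy; split=> [i|]; first by
  rewrite dotZl dotDl; have := hx i; have := hy i; lra.
apply/setP => i; rewrite !inE dotZl dotDl.
apply/eqP/andP => [h|[/eqP-> /eqP->]]; last by lra.
by have := hx i; have := hy i; split; apply/eqP; lra.
Qed.

(** A tight set of least cardinality works: the midpoint with any other point has the intersection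
    as tight set, which cannot be smaller. Such a point lies in the relative interior. *)
Lemma exists_min_tight c (A : set 'rV[R]_d) : A `<=` solutions c -> A !=set0 ->
  (forall x y, A x -> A y -> A (2^-1 *: (x + y))) ->
  exists2 x, A x & forall y, A y -> tight c x \subset tight c y.
Proof.
move=> AP [x0 Ax0] Amid.
have [m [x Ax xm] mmin] : exists2 m, (exists2 x, A x & #|tight c x| = m) &
    forall x, A x -> (m <= #|tight c x|)%N.
  have ex : exists m, `[< exists2 x, A x & #|tight c x| = m >].
    by exists #|tight c x0|; apply/asboolP; exists x0.
  exists (ex_minn ex); case: ex_minnP => m /asboolP// _ mmin x Ax.
  by apply: mmin; apply/asboolP; exists x.
exists x => // y Ay; have [_ eT] := tight_midpoint (AP _ Ax) (AP _ Ay).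
have := mmin _ (Amid _ _ Ax Ay); rewrite eT -xm => h.
by apply/finset.setIidPl/eqP; rewrite eqEcard finset.subsetIl h.
Qed.

(* A point of the tangent cone is an infinitesimal step from [z] into the
   polyhedron, so both have the same strata near the apex. *)
Lemma tangent_cone_step c z w : solutions c z ->
  (forall i, i \in tight c z -> dot w (u i) <= 0) ->
  exists2 t : R, 0 < t & solutions c (z + t *: w) /\
    tight c (z + t *: w) = [set i in tight c z | dot w (u i) == 0].
Proof.
move=> hz hw.
have [i|e e0 He] := @small_forall R 'I_k (fun i t => i \notin tight c z ->
    dot (z + t *: w) (u i) < c i).
  have [iz|iz] := boolP (i \in tight c z); first by exists 1.
  have lti : dot z (u i) < c i by rewrite lt_neqAle hz andbT; rewrite inE in iz.
  have [e e0 He] := small_lt (dot w (u i)) lti; exists e => // t te _.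
  by rewrite dotDl dotZl; exact: He.
have t0 : 0 < e / 2 by rewrite divr_gt0.
have {}He : forall i, i \notin tight c z -> dot (z + (e / 2) *: w) (u i) < c i.
  by apply: He; rewrite gtr0_norm//; lra.
exists (e / 2) => //; split=> [i|].
  have [iz|/He/ltW//] := boolP (i \in tight c z).
  rewrite dotDl dotZl (tightP _ _ _ iz) gerDl.
  by rewrite mulr_ge0_le0 ?hw// ltW.
apply/setP => i; rewrite [LHS]inE [RHS]inE.
have [iz|iz] := boolP (i \in tight c z); last by rewrite lt_eqF// He.
by rewrite dotDl dotZl (tightP _ _ _ iz) -subr_eq0 addrAC subrr add0r mulf_eq0 gt_eqF.
Qed.

(** Moving along [w] stays in the cone, while moving backwards eventually violates the inequality
    [i0]. Lines parallel to [w] thus meet the cone in a closed ray or not at all, of characteristic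
    0. *)
Lemma euler_pointed_cone I w : (forall i, i \in I -> dot w (u i) <= 0) ->
  (exists2 i, i \in I & dot w (u i) < 0) ->
  line_integral w (fun x => ind (forall i, i \in I -> dot x (u i) <= 0)) (fun=> 0).
Proof.
move=> hw [i0 iI0 hi0] x.
pose C : set 'rV[R]_d := [set x | forall i, i \in I -> dot x (u i) <= 0].
have [[t0 Ct0]|nC] := pselect (saturate w C x); last first.
  apply: euler1_ext euler1_0 => t.
  by rewrite indF// => Ct; apply: nC; exists t.
have pC : polyhedron C.
  apply: polyhedron_forall => i; have [iI|iI] := boolP (i \in I).
    have := polyhedron_halfspace (u i) 0; congr polyhedron.
    by apply/seteqP; split => y /=; [move=> ? _|apply].
  by exists [::]; apply/seteqP; split.
have Cup s t : s <= t -> C (x + s *: w) -> C (x + t *: w).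
  move=> st Cs i iI; have := Cs i iI; have := hw i iI; rewrite !dotDl !dotZl.
  by nra.
have [h|[a a0 ha]] := polyhedron_line_min pC Ct0.
  (* The parameter at which inequality [i0] is tight; it fails at every smaller one. *)
  pose b := - dot x (u i0) / dot w (u i0).
  have bt0 : t0 <= t0 + 0 by rewrite addr0.
  have := h (Num.min t0 b - 1); rewrite lerBlDr ge_min ler_wpDr//= => /(_ isT).
  move=> /(_ _ iI0); rewrite dotDl dotZl => hC.
  have hb : Num.min t0 b <= b by rewrite ge_min lexx orbT.
  have eb : b * dot w (u i0) = - dot x (u i0) by rewrite /b divfK// lt_eqF.
  by exfalso; nra.
apply: euler1_ext (euler1_ge a) => t; apply: ind_ext.
have [tt0|/ltW tt0] := leP t t0; first by rewrite -ha.
by split=> [_|_]; [exact: Cup Ct0|exact: le_trans tt0].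
Qed.

(** The faces containing [z] correspond to the strata of the tangent cone at [z], so the sum is the
    Euler characteristic of that cone. It vanishes unless [z] is in the relative interior, where the
    whole polyhedron is the only such face. *)
Lemma sum_face_sign_above c z p0 : solutions c z -> solutions c p0 ->
  (forall y, solutions c y -> tight c p0 \subset tight c y) ->
  \sum_(J | face_index c J && (J \subset tight c z)) face_sign J =
    face_sign (tight c p0) * ind (tight c z = tight c p0).
Proof.
move=> hz hp minp; have [zp|zp] := eqVneq (tight c z) (tight c p0).
  rewrite indT// mulr1 (big_pred1 (tight c p0))// => J; rewrite zp.
  apply/andP/eqP => [[/face_indexP[y hy <-] Jp]|->]; last by
    rewrite face_index_tight.
  by apply/eqP; rewrite finset.eqEsubset Jp minp.
rewrite indF ?mulr0; last by move=> /eqP; rewrite (negbTE zp).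
pose w := p0 - z.
have hw i : i \in tight c z -> dot w (u i) <= 0.
  by move=> /tightP iz; rewrite dotBl iz subr_le0.
have w0 : exists2 i, i \in tight c z & dot w (u i) < 0.
  have : tight c p0 \proper tight c z.
    by rewrite finset.properEneq minp// andbT eq_sym.
  case/fintype.properP => _ [i iz ip]; exists i => //; rewrite lt_neqAle hw// andbT.
  by move: ip; rewrite inE; apply: contraNN; rewrite dotBl (tightP _ _ _ iz) subr_eq0.
(* A basis starting with [w], so that the very first integration already gives 0. *)
pose ws := w :: vbasis (<[w]>^C).
have ws1 : (<<ws>> = fullv)%VS.
  by rewrite span_cons (span_basis (vbasisP _)) addv_complf.
have wn0 : w != 0.
  by case: w0 => i _; apply: contraTneq => ->; rewrite dot0l ltxx.
have sws : size ws = \dim {:'rV[R]_d}.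
  rewrite /= size_tuple dimv_compl dim_vline wn0 subn1 prednK//.
  by apply: leq_trans (dimvS (subvf <[w]>)); rewrite dim_vline wn0.
have e0 : euler ws (fun x => ind (forall i, i \in tight c z -> dot x (u i) <= 0)) 0.
  by exists (fun=> 0); [exact: euler_pointed_cone|exact: euler0].
apply: euler_unique e0.
under eq_bigr do rewrite -[face_sign _]mul1r.
pose St J := stratum (fun=> 0) (tight c z) J.
apply: euler_ext (euler_sum (F := fun J x => ind (St J x)) _ (fun=> 1) _); last first.
  move=> J /andP[/face_indexP[y hy yJ] Jz]; apply: euler_rel_open_basis => //.
    exact: stratum_rel_open.
  exists (y - z) => i iz; rewrite dotBl (tightP _ _ _ iz); case: ifPn.
    by rewrite -yJ => /tightP->; rewrite subrr.
  by rewrite -yJ inE subr_lt0 lt_neqAle hy andbT.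
move=> x; under eq_bigr do rewrite mul1r.
have [Cx|nCx] := pselect (forall i, i \in tight c z -> dot x (u i) <= 0); last first.
  rewrite indF// big1// => J _; rewrite indF// => Sx; apply: nCx => i iz.
  by have := Sx i iz; case: ifP => _ => [->|/ltW].
pose T := [set i in tight c z | dot x (u i) == 0].
(* [T] is the only stratum through [x]; a small step from [z] along [x] shows that it belongs to a
   face. *)
rewrite indT// (bigD1 T)/=; last first.
  have [t t0 [ht tE]] := tangent_cone_step hz Cx.
  rewrite -{1}[T]tE face_index_tight//=.
  by apply/fintype.subsetP => i; rewrite inE => /andP[].
rewrite indT; last first.
  move=> i iz; rewrite inE iz /=; case: eqVneq => // x0.
  by rewrite lt_neqAle x0 Cx.
rewrite big1 ?addr0// => J /andP[/andP[_ /fintype.subsetP Jz] JT]; rewrite indF//.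
move=> Sx; move/eqP: JT; apply; apply/setP => i; rewrite inE.
have [iz|iz] := boolP (i \in tight c z); last first.
  by apply: contraNF iz; exact: Jz.
have := Sx i iz; case: ifP => _ => [->|/lt_eqF->//]; by rewrite eqxx.
Qed.

End Faces.

(** * Signed sums over faces *)

(** The Minkowski sum of [A] with the reflection of [B], not the erosion of [A] by [B]. *)
Definition diff (R : realType) d (A B : set 'rV[R]_d) : set 'rV[R]_d :=
  [set x | exists2 y, B y & A (x + y)].

Lemma polyhedron_diff (R : realType) d (A B : set 'rV[R]_d) :
  polyhedron A -> polyhedron B -> polyhedron (diff A B).
Proof.
move=> hA hB; have := polyhedron_sum hA (polyhedron_opp hB).
congr polyhedron; apply/seteqP; split => x /=.
  by move=> [a Aa [b Bb <-]]; exists (- b) => //; rewrite addrK.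
by move=> [y By Axy]; exists (x + y) => //; exists (- y); rewrite /= ?opprK// addrK.
Qed.

Lemma bounded_diff (R : realType) d (A B : set 'rV[R]_d) :
  bounded A -> bounded B -> bounded (diff A B).
Proof.
move=> [M hM] [N hN]; exists (M + N) => x [y By Axy] j.
rewrite -[x](addrK y) mxE (le_trans (ler_normD _ _))// lerD//; first exact: hM.
by rewrite mxE normrN; exact: hN.
Qed.

Lemma bounded_sum (R : realType) d (A B : set 'rV[R]_d) :
  bounded A -> bounded B -> bounded (minkowski_sum A B).
Proof.
move=> [M hM] [N hN]; exists (M + N) => _ [x Ax [y By <-]] j.
by rewrite mxE (le_trans (ler_normD _ _))// lerD//; [exact: hM|exact: hN].
Qed.

Lemma bounded_point (R : realType) d (y : 'rV[R]_d) : bounded [set x | x = y].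
Proof.
exists (\sum_j `|y 0 j|) => _ -> j; rewrite (bigD1 j)//= lerDl.
by apply: sumr_ge0.
Qed.

Section FaceSums.
Context {R : realType} {d k : nat}.
Variables (u : 'I_k -> 'cV[R]_d) (c : 'I_k -> R).
Implicit Types (J : {set 'I_k}) (x y z : 'rV[R]_d).

Local Notation P := (solutions u c).
Local Notation F := (tight_face u c).
Hypotheses (bP : bounded P) (P0 : P !=set0).

Lemma tight_face_sub J : F J `<=` P.
Proof. by move=> x []. Qed.

(** Euler's relation: the relative interiors of the faces partition [P], each contributes its sign,
    and [P] has characteristic 1. *)
Lemma sum_face_sign : \sum_(J | face_index u c J) face_sign u J = 1.
Proof.
have := euler_polytope (polyhedron_solutions u c) bP.
rewrite (indT P0) => e1; apply/esym/(euler_unique e1).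
under eq_bigr do rewrite -[face_sign _ _]mul1r.
apply: euler_ext (euler_sum (F := fun J x => ind (stratum u c finset.setT J x))
  _ (fun=> 1) _); last first.
  move=> J /asboolP hJ; apply: euler_rel_open_basis => //.
  - by apply: stratum_rel_open; exact: finset.subsetT.
  - exact: std_basis_full.
  - exact: size_std_basis.
move=> x; under eq_bigr do rewrite mul1r.
have [Px|nPx] := pselect (P x); last first.
  by rewrite indF// big1// => J _; rewrite indF// => /stratumT[].
rewrite indT// (bigD1 (tight u c x)) ?face_index_tight//= indT; last exact/stratumT.
rewrite big1 ?addr0// => J /andP[_ /eqP xJ]; rewrite indF// => /stratumT[_ Jx].
exact: xJ.
Qed.

Section MinimalTight.
Variable p0 : 'rV[R]_d.
Hypotheses (hp0 : P p0)
  (minp0 : forall y, P y -> tight u c p0 \subset tight u c y).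

(** The right-hand side is the signed indicator of the relative interior of [P]; at a point of [P]
    the left-hand sum runs over the faces through that point. *)
Lemma sum_face_indicator x :
  \sum_(J | face_index u c J) face_sign u J * ind (F J x) =
  face_sign u (tight u c p0) * ind (P x /\ tight u c x = tight u c p0).
Proof.
have [Px|nPx] := pselect (P x); last first.
  by rewrite indF ?mulr0 ?big1// => [J _|[]//]; rewrite indF ?mulr0// => -[].
rewrite (ind_ext (_ : _ <-> tight u c x = tight u c p0)); last by split => [[]|].
rewrite -(sum_face_sign_above Px hp0 minp0) [RHS]big_mkcondr /=.
apply: eq_bigr => J _; case: ifP => Jx; first by rewrite indT ?mulr1.
by rewrite indF ?mulr0// => -[_]; rewrite Jx.
Qed.

(* The open polytope and its shift by [- x] meet a line parallel to [x] in a
   half-open interval. *)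
Lemma euler1_shifted_open x y : x != 0 ->
  euler1 (fun t => ind ((P (y + t *: x) /\ tight u c (y + t *: x) = tight u c p0) /\
                        P (y + t *: x + x))) 0.
Proof.
move=> x0.
pose T t := (P (y + t *: x) /\ tight u c (y + t *: x) = tight u c p0) /\
  P (y + t *: x + x).
rewrite -/(euler1 (fun t => ind (T t)) 0).
have [[t0 Tt0]|nT] := pselect (exists t, T t); last first.
  by apply: euler1_ext euler1_0 => t; rewrite indF// => Tt; apply: nT; exists t.
have [j xj] : exists j, x 0 j != 0.
  by apply/existsP; apply: contraNT x0; rewrite negb_exists => /forallP h;
    apply/eqP/rowP => j; rewrite mxE; apply/eqP; rewrite -[_ == _]negbK.
have [M hM] : exists M, forall t, P (y + t *: x) -> `|t| <= M.
  case: bP => M hM; apply: (bounded_coord_line xj (M := M)) => z /hM; exact.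
have shift t : y + t *: x + x = y + (t + 1) *: x.
  by rewrite -addrA scalerDl scale1r.
have [ht0 Pt0x] := Tt0; have Pt0 := ht0.1; rewrite shift in Pt0x.
have [a [b hab]] := polyhedron_line_itv (polyhedron_solutions u c) Pt0 hM.
have /andP[at0 t0b] := (hab _).1 Pt0; have /andP[_ t0b'] := (hab _).1 Pt0x.
have Pa : P (y + a *: x) by apply/hab; rewrite lexx (le_trans at0).
(* The lower end [a] is not in the open polytope: from there one could still step backwards along
   [x], which is a direction of [P]. *)
have ta : tight u c (y + a *: x) <> tight u c p0.
  move=> /(conj Pa)/stratumT Oa.
  have [_ _ op] := @stratum_rel_open _ _ _ u c finset.setT _ (finset.subsetT (tight u c p0)).
  have xann : x \in annihilator u (tight u c p0).
    apply/annihilatorP => i ip.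
    have h1 := tightP _ _ _ _ (fintype.subsetP (minp0 Pa) _ ip).
    have h2 := tightP _ _ _ _ (fintype.subsetP (minp0 Pt0x) _ ip).
    move: h1; rewrite -h2 !dotDl !dotZl => /addrI /eqP.
    rewrite -subr_eq0 -mulrBl mulf_eq0 => /orP[/eqP|/eqP//].
    by move: at0; lra.
  have [e e0 /(_ (- (e / 2)))] := op _ _ Oa xann.
  rewrite normrN gtr0_norm ?divr_gt0// => He.
  have /He/stratumT[+ _] : e / 2 < e by move: e0; lra.
  by rewrite -addrA -scalerDl => /hab; move: e0; lra.
have ab : a <= b - 1 by move: at0 t0b'; lra.
have ab' : a <= b by exact: le_trans at0 t0b.
(* The set is the interval from [a], excluded, to [b - 1], included: a closed segment minus its
   lower end. *)
have := euler1D (euler1_itv ab) (euler1Z (-1) (euler1_itv (lexx a))).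
rewrite mulr1 subrr; apply: euler1_ext => t.
have [at_|ta'|tea] := ltgtP a t.
- rewrite /= [ind false]indF// mulr0 addr0.
  apply: ind_ext; rewrite /T shift; split=> [tb|[[_ _] /hab]]; last first.
    by lra.
  have [Pt Ptx] : P (y + t *: x) /\ P (y + (t + 1) *: x).
    by split; apply/hab; move: at_ tb; lra.
  split => //; split => //.
  apply/eqP; rewrite finset.eqEsubset minp0// andbT -ht0.2.
  apply/fintype.subsetP => i /tightP; rewrite dotDl dotZl => it.
  have := Pa i; have := (hab b).2 _ i; rewrite lexx ab' => /(_ isT).
  rewrite !dotDl !dotZl -it => hb ha.
  (* An affine function that attains its maximum over the segment at an inner point is constant
     along it. *)
  have d0 : dot x (u i) = 0 by move: ha hb at_ tb; nra.
  by apply/tightP; rewrite dotDl dotZl -it d0 !mulr0.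
- rewrite /= !indF//; last by move=> [[/hab/andP[]]]; rewrite leNgt ta'.
- rewrite -tea ab /= [ind true]indT// mulN1r addrN indF// => -[[_ /ta]].
  by [].
Qed.

(** [x] lies in [P - F] exactly when [F] meets [P - x]. The signed sum of the indicators of these
    intersections is, up to sign, that of the open polytope cut by [P - x], which integrates to 0
    along [x]. *)
Lemma sum_face_diff x : x != 0 ->
  \sum_(J | face_index u c J) face_sign u J * ind (diff P (F J) x) = 0.
Proof.
move=> x0.
pose A J : set 'rV[R]_d := F J `&` [set z | P (x + z)].
have pA J : polyhedron (A J).
  apply: polyhedronI; first exact: polyhedron_tight_face.
  exact/polyhedron_translate/polyhedron_solutions.
have bA J : bounded (A J) by apply: boundedS bP => z [[]].
have [j xj] : exists j, x 0 j != 0.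
  by apply/existsP; apply: contraNT x0; rewrite negb_exists => /forallP h;
    apply/eqP/rowP => j; rewrite mxE; apply/eqP; rewrite -[_ == _]negbK.
have line_bounded J z : exists M, forall t, A J (z + t *: x) -> `|t| <= M.
  by case: (bA J) => M hM; apply: (bounded_coord_line xj (M := M)) => y /hM; exact.
have line y : \sum_(J | face_index u c J) face_sign u J * ind (saturate x (A J) y) = 0.
  have h := euler1_sum (index_enum {set 'I_k}) (face_sign u) (fun J _ =>
    polyhedron_line_integral (pA J) (line_bounded J) y).
  apply: euler1_unique (h (face_index u c)) _.
  have := euler1Z (face_sign u (tight u c p0)) (euler1_shifted_open y x0).
  rewrite mulr0; apply: euler1_ext => t.
  have [Px|nPx] := pselect (P (y + t *: x + x)).
    transitivity (\sum_(J | face_index u c J) face_sign u J * ind (F J (y + t *: x))).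
      rewrite sum_face_indicator; congr (_ * _); apply: ind_ext.
      by split => [[]|].
    apply: eq_bigr => J _; congr (_ * _); apply: ind_ext.
    by split => [|[]//]; split => //=; rewrite addrC.
  rewrite indF; last by move=> [].
  rewrite mulr0 big1// => J _; rewrite indF ?mulr0// => -[_ /=].
  by rewrite addrC.
have pj : polyhedron [set z : 'rV[R]_d | z 0 j = 0].
  have := polyhedronI (polyhedron_le j 0) (polyhedron_ge j (0 : R)).
  congr polyhedron; apply/seteqP; split => z /=; last by move=> ->.
  by move=> [z0 z0']; apply/le_anti; rewrite z0.
(* Each line parallel to [x] crosses the hyperplane once since [x 0 j] is nonzero, so this section
   is a bounded copy of the projection. *)
pose B J := saturate x (A J) `&` [set z | z 0 j = 0].
have -> : \sum_(J | face_index u c J) face_sign u J * ind (diff P (F J) x) =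
    \sum_(J | face_index u c J) face_sign u J * ind (B J !=set0).
  apply: eq_bigr => J _; congr (_ * _); apply: ind_ext; split.
    move=> [y Fy Py]; exists (y - (y 0 j / x 0 j) *: x); split.
      by exists (y 0 j / x 0 j); rewrite subrK.
    by rewrite /= !mxE divfK// subrr.
  by move=> [z [[t [Fz Pz]] _]]; exists (z + t *: x).
transitivity (ind ((set0 : set 'rV[R]_d) !=set0)); last by rewrite indF// => -[z].
  apply: euler_relation => [J _|||z].
  - split.
      by apply: polyhedronI => //; exact: polyhedron_saturate.
    case: bP => M hM; have [N hN] := bounded_point x.
    exists (M + M / `|x 0 j| * N) => z [[t [/tight_face_sub/hM hz _]] /= zj] i.
    have : `|t| <= M / `|x 0 j|.
      have := hz j; rewrite !mxE zj add0r normrM.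
      by rewrite ler_pdivlMr// normr_gt0.
    move=> tM; have -> : z 0 i = (z + t *: x) 0 i - t * x 0 i.
      by rewrite !mxE addrK.
    rewrite (le_trans (ler_normD _ _))// lerD// normrN normrM.
    by apply: ler_pM => //; exact: hN.
  - exact: polyhedron_set0.
  - exact: bounded_set0.
  - rewrite [RHS]indF//; have [zj|zj] := eqVneq (z 0 j) 0.
      apply: etrans (line z); apply: eq_bigr => J _; congr (_ * _).
      by apply: ind_ext; split => [[]|].
    rewrite big1// => J _; rewrite indF ?mulr0// => -[_ /=].
    by apply/eqP.
Qed.

End MinimalTight.

End FaceSums.

(** * Cancellation of a polytope, and its complement complex *)

Section FaceComplex.
Context {R : realType} {d k : nat}.
Variables (u : 'I_k -> 'cV[R]_d) (c : 'I_k -> R).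
Implicit Types (J : {set 'I_k}) (x y z : 'rV[R]_d).

Local Notation P := (solutions u c).
Local Notation F := (tight_face u c).
Hypotheses (bP : bounded P) (P0 : P !=set0).

Lemma tight_face_neq0 J : face_index u c J -> F J !=set0.
Proof. by move=> /face_indexP[x Px <-]; exists x; split. Qed.

(** The signed indicators of the sets [P - F] sum to the indicator of the origin: off 0 the sum
    vanishes, at 0 it is Euler's relation. Intersecting with [v - K] and passing to nonemptiness
    introduces the summand [K]. *)
Lemma sum_face_cancel (K : set 'rV[R]_d) v : polyhedron K ->
  \sum_(J | face_index u c J)
     face_sign u J * ind (diff (minkowski_sum K P) (F J) v) = ind (K v).
Proof.
move=> hK.
have [p0 Pp0 minp0] : exists2 p0, P p0 & forall y, P y -> tight u c p0 \subset tight u c y.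
  by apply: exists_min_tight => // x y Px Py; have [] := tight_midpoint Px Py.
have h x : \sum_(J | face_index u c J) face_sign u J * ind (diff P (F J) x) = ind (x = 0).
  have [->|x0] := eqVneq x 0; last first.
    by rewrite (sum_face_diff bP Pp0 minp0 x0) indF//; exact/eqP.
  rewrite (indT erefl) -(sum_face_sign bP P0); apply: eq_bigr => J /tight_face_neq0[y Fy].
  rewrite indT ?mulr1//; exists y => //; rewrite add0r; exact: tight_face_sub Fy.
pose K' : set 'rV[R]_d := [set x | K (v + - x)].
have hK' : polyhedron K'.
  exact: (polyhedron_opp (polyhedron_translate v hK)).
pose A J := diff P (F J) `&` K'.
transitivity (\sum_(J | face_index u c J) face_sign u J * ind (A J !=set0)).
  apply: eq_bigr => J _; congr (_ * _); apply: ind_ext; split.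
    move=> [y Fy [q Kq [p Pp qp]]]; exists (p - y); split.
      by exists y => //; rewrite subrK.
    suff -> : K' (p - y) = K q by [].
    by rewrite /K'/= opprB addrA -qp addrK.
  move=> [x [[y Fy Pxy] Kx]]; exists y => //; exists (v - x) => //.
  by exists (x + y) => //; rewrite addrA subrK.
transitivity (ind (([set x | x = 0] `&` K') !=set0)); last first.
  apply: ind_ext; split => [[x [/= -> ]]|Kv]; rewrite ?/K' /= ?subr0//.
  by exists 0; split => //=; rewrite subr0.
apply: euler_relation => [J _|||x].
- split.
    apply: polyhedronI => //; apply: polyhedron_diff.
      exact: polyhedron_solutions.
    exact: polyhedron_tight_face.
  apply: (@boundedS _ _ _ (diff P (F J))); first by move=> x [].
  by apply: bounded_diff => //; apply: boundedS bP; exact: tight_face_sub.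
- by apply: polyhedronI => //; exact: polyhedron_point.
- by apply: boundedS (bounded_point 0) => x [].
- have [Kx|nKx] := pselect (K' x).
    transitivity (ind (x = 0)); last by apply: ind_ext; split=> [|[]].
    by rewrite -h; apply: eq_bigr => J _; congr (_ * _); apply: ind_ext; split=> [[]|].
  rewrite [RHS]indF; last by move=> [].
  by rewrite big1// => J _; rewrite indF ?mulr0// => -[].
Qed.

(** A point whose tight set is exactly [J] can be moved slightly along every vector of the
    annihilator without leaving the face. *)
Lemma affine_dim_tight_face J : face_index u c J ->
  affine_dim (F J) = (\dim (annihilator u J))%:Z.
Proof.
move=> iJ; have [x0 Fx0] := tight_face_neq0 iJ.
rewrite /affine_dim ifF; last by apply/eqP => F0; rewrite F0 in Fx0.
have sub x y : F J x -> F J y -> x - y \in annihilator u J.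
  move=> [_ Jx] [_ Jy]; apply/annihilatorP => i iJ'; rewrite dotBl.
  have /tightP -> := fintype.subsetP Jx _ iJ'.
  by have /tightP -> := fintype.subsetP Jy _ iJ'; rewrite subrr.
have least (V : {vspace 'rV[R]_d}) : (forall x y, F J x -> F J y -> x - y \in V) ->
    (annihilator u J <= V)%VS.
  move=> hV; apply/subvP => w wJ; have /face_indexP[x Px xJ] := iJ.
  have Sx : stratum u c finset.setT J x by apply/stratumT.
  have [_ _ op] := @stratum_rel_open _ _ _ u c finset.setT _ (finset.subsetT J).
  have [e e0 /(_ (e / 2))] := op _ _ Sx wJ.
  rewrite gtr0_norm ?divr_gt0// => He.
  have /He/stratumT[Py yJ] : e / 2 < e.
    by rewrite ltr_pdivrMr// mulr_natr mulr2n ltrDl.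
  have e2 : e / 2 != 0 by rewrite gt_eqF// divr_gt0.
  rewrite -[w](scalerK e2) memvZ//.
  have -> : (e / 2) *: w = x + (e / 2) *: w - x by rewrite addrAC subrr add0r.
  by apply: hV; split; rewrite ?yJ ?xJ.
congr (\dim _)%:Z; apply: xget_unique => [|V [h1 h2]]; first by split.
by apply/eqP; rewrite eqEsubv h2//= least.
Qed.

(** The sum of the inequalities in [J] supports the face: it is tight only where each summand is. *)
Lemma face_tight_face J : face P (F J).
Proof.
exists (\sum_(i in J) u i), (\sum_(i in J) c i); split => [x Px|].
  by rewrite -/(dot x _) dot_sumr; apply: ler_sum.
apply/seteqP; split => x /= [Px].
  move=> /fintype.subsetP Jx; split => //; rewrite -/(dot x _) dot_sumr.
  by apply: eq_bigr => i /Jx/tightP.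
rewrite -/(dot x _) dot_sumr => h; split => //.
apply/fintype.subsetP => i iJ; apply/tightP.
have h0 : \sum_(j in J) (c j - dot x (u j)) = 0 by rewrite sumrB -h subrr.
have ge0 j : j \in J -> 0 <= c j - dot x (u j) by move=> _; rewrite subr_ge0.
by apply/esym/subr0_eq; exact: psumr_eq0P ge0 h0 _ iJ.
Qed.

(** [J] is the tight set of a relative interior point [x] of [G]. For [y] in the face of [J], the
    segment from [y] to [x] extends a little beyond [x] inside [P], so the functional cannot be
    smaller at [y] than at [x]. *)
Lemma faceP (G : set 'rV[R]_d) :
  face P G -> G !=set0 -> exists2 J, face_index u c J & G = F J.
Proof.
move=> [v [b [vb GE]]] G0.
have [|//||x Gx minx] := @exists_min_tight _ _ _ u c G.
- by rewrite GE => y [].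
- rewrite GE => y z [Py yb] [Pz zb]; split; first by have [] := tight_midpoint Py Pz.
  by move: yb zb; rewrite -!/(dot _ _) dotZl dotDl => -> ->; lra.
have [Px xb] : P x /\ (x *m v) 0 0 = b by move: Gx; rewrite GE.
exists (tight u c x); first exact: face_index_tight.
apply/seteqP; split => y; first by move=> Gy; split; [move: Gy; rewrite GE => -[]|exact: minx].
move=> [Py xy]; rewrite GE; split => //; apply/le_anti; rewrite vb//=.
have Sx : stratum u c finset.setT (tight u c x) x by apply/stratumT.
have [_ _ op] := @stratum_rel_open _ _ _ u c finset.setT _ (finset.subsetT (tight u c x)).
have xyJ : x - y \in annihilator u (tight u c x).
  apply/annihilatorP => i ix; rewrite dotBl (tightP _ _ _ _ ix).
  by rewrite (tightP _ _ _ _ (fintype.subsetP xy _ ix)) subrr.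
have [e e0 /(_ (e / 2))] := op _ _ Sx xyJ.
rewrite gtr0_norm ?divr_gt0// => He.
have e2 : 0 < e / 2 by rewrite divr_gt0.
have /He/stratumT[/vb + _] : e / 2 < e.
  by rewrite ltr_pdivrMr// mulr_natr mulr2n ltrDl.
move: xb; rewrite -!/(dot _ _) dotDl dotZl dotBl => ->.
by rewrite gerDl pmulr_rle0// subr_le0.
Qed.

Lemma tight_face_inj J J' : face_index u c J -> face_index u c J' ->
  F J = F J' -> J = J'.
Proof.
move=> /face_indexP[x Px xJ] /face_indexP[x' Px' xJ'] FF; apply/eqP.
rewrite finset.eqEsubset; apply/andP; split.
  have [_] : F J x' by rewrite FF; split; rewrite ?xJ'.
  by rewrite xJ'.
have [_] : F J' x by rewrite -FF; split; rewrite ?xJ.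
by rewrite xJ.
Qed.

Lemma reduced_euler_complement (Q : set 'rV[R]_d) :
  reduced_euler (complement_complex Q P) =
  - \sum_(J | face_index u c J) face_sign u J * ind ((F J `&` Q) !=set0).
Proof.
pose r := [seq J <- enum {set 'I_k} | face_index u c J && `[< F J `&` Q = set0 >]].
have rP J : J \in r = face_index u c J && `[< F J `&` Q = set0 >].
  by rewrite mem_filter mem_enum andbT.
have -> : complement_complex Q P = [set` set0 :: [seq F J | J <- r]].
  apply/seteqP; split => G /=.
    move=> [fG GQ]; have [G0|G0] := pselect (G !=set0); last first.
      by rewrite inE; apply/orP; left; apply/eqP/seteqP; split => // x Gx;
        apply: G0; exists x.
    have [J iJ GJ] := faceP fG G0; rewrite inE; apply/orP; right.
    by rewrite GJ; apply: map_f; rewrite rP iJ/=; apply/asboolP; rewrite -GJ.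
  rewrite inE => /orP[/eqP->|/mapP[J + ->]].
    split; last by rewrite set0I.
    exists 0, 1; split=> [x _|]; first by rewrite mulmx0 mxE.
    apply/seteqP; split => // x /= [_]; rewrite mulmx0 mxE => /eqP.
    by rewrite eq_sym oner_eq0.
  by rewrite rP => /andP[_ /asboolP]; split => //; exact: face_tight_face.
rewrite /reduced_euler -fsbig_seq; last first.
  rewrite /= map_inj_in_uniq; last first.
    move=> J J'; rewrite !rP => /andP[iJ _] /andP[iJ' _]; exact: tight_face_inj.
  rewrite filter_uniq ?enum_uniq// andbT.
  apply/negP => /mapP[J]; rewrite rP => /andP[/tight_face_neq0[x Fx] _] F0.
  by rewrite -F0 in Fx.
rewrite big_cons big_map big_filter big_enum_cond {1}/affine_dim eqxx /=.
(* The -1 comes from the empty face and cancels the total sign 1 of the nonempty ones. *)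
transitivity (-1 + \sum_(J | face_index u c J)
    (face_sign u J - face_sign u J * ind ((F J `&` Q) !=set0))); last first.
  by rewrite sumrB (sum_face_sign bP P0) addrA subrr add0r.
congr (_ + _); rewrite (eq_bigl (fun J => face_index u c J && `[< F J `&` Q = set0 >]))//.
rewrite big_mkcondr; apply: eq_bigr => J iJ; rewrite affine_dim_tight_face//.
case: asboolP => FQ.
  by rewrite indF ?mulr0 ?subr0// FQ => -[].
rewrite indT ?mulr1 ?subrr//; apply: contrapT => nFQ; apply: FQ.
by apply/seteqP; split => // x Fx; apply: nFQ; exists x.
Qed.

End FaceComplex.

(** * Lattice polytopes *)

Section ConvexSets.
Context {R : realType} {d : nat}.
Implicit Types (A B C : set 'rV[R]_d).

Lemma convex_setP A : @convex_set R 'rV[R]_d A <-> cvx A.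
Proof.
have convE (x y : 'rV[R]_d) (t : {i01 R}) :
    conv t (x : convex_lmodType 'rV[R]_d) y = y + t%:num *: (x - y).
  transitivity (t%:num *: x + (1 - t%:num) *: y); first by [].
  by rewrite scalerBl scale1r scalerBr addrCA.
split=> [cA x y t Ax Ay /andP[t0 t1]|cA x y t].
  (* In [conv t x y] the weight [t] sits on [x], hence the exchanged endpoints. *)
  have := cA y x (Itv01 t0 t1) (mem_set Ay) (mem_set Ax).
  by rewrite convE => /set_mem.
rewrite !inE => Ax Ay; rewrite convE; apply: cA => //.
by apply/andP; split; [exact: ge0|exact: le1].
Qed.

Lemma minkowski_sumA A B C :
  minkowski_sum A (minkowski_sum B C) = minkowski_sum (minkowski_sum A B) C.
Proof.
apply/seteqP; split => x.
  move=> [a Aa [_ [b Bb [e Ce <-]] <-]]; exists (a + b); first by exists a => //; exists b.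
  by exists e => //; rewrite addrA.
move=> [_ [a Aa [b Bb <-]] [e Ce <-]]; exists a => //; exists (b + e).
  by exists b => //; exists e.
by rewrite addrA.
Qed.

Lemma minkowski_sumC A B : minkowski_sum A B = minkowski_sum B A.
Proof.
by apply/seteqP; split => _ [a Aa [b Bb <-]]; exists b => //; exists a => //;
  rewrite addrC.
Qed.

Lemma dilate0 A : A !=set0 -> dilate 0 A = [set x | x = 0].
Proof.
move=> [a Aa]; apply/seteqP; split => x /=; first by move=> [y _ <-]; rewrite scale0r.
by move=> ->; exists a => //; rewrite scale0r.
Qed.

Lemma dilate1 A : dilate 1 A = A.
Proof.
apply/seteqP; split => x /=; first by move=> [y Ay <-]; rewrite scale1r.
by move=> Ax; exists x; rewrite ?scale1r.
Qed.

Lemma dilateS m A : cvx A -> dilate m.+1 A = minkowski_sum (dilate m A) A.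
Proof.
move=> cA; apply/seteqP; split => x.
  move=> [y Ay <-]; exists (m%:R *: y); first by exists y.
  by exists y => //; rewrite -natr1 scalerDl scale1r.
(* The mean of [y] with weight m and [z] with weight 1. *)
move=> [_ [y Ay <-] [z Az <-]]; exists (y + m.+1%:R^-1 *: (z - y)).
  apply: cA => //; rewrite invr_ge0 ler0n/= invf_le1 ?ltr0n// ler1n; exact: isT.
rewrite scalerDr scalerA mulfV ?pnatr_eq0// scale1r -natr1 scalerDl scale1r.
by rewrite -addrA subrKC.
Qed.

Lemma bounded_dilate m A : bounded A -> bounded (dilate m A).
Proof.
move=> [M hM]; exists (m%:R * M) => _ [x Ax <-] j; rewrite mxE normrM normr_nat.
by apply: ler_wpM2l => //; exact: hM.
Qed.

Lemma polyhedron_dilate m A : A !=set0 -> polyhedron A -> polyhedron (dilate m A).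
Proof.
move=> A0 pA; elim: m => [|m IH].
  by rewrite dilate0//; exact: polyhedron_point.
rewrite dilateS; last exact: polyhedron_cvx.
exact: polyhedron_sum.
Qed.

End ConvexSets.

(** * Barycentric coordinates on lattice polytopes *)

Section Simplices.
Context {R : realType}.

Definition simplex r (s : R) : set 'rV[R]_r :=
  [set y | (forall i, 0 <= y 0 i) /\ \sum_i y 0 i = s].

Lemma polyhedron_sum_eq r (s : R) : polyhedron [set y : 'rV[R]_r | \sum_i y 0 i = s].
Proof.
have e (y : 'rV[R]_r) : dot y (\sum_(i < r) delta_mx i 0) = \sum_i y 0 i.
  by rewrite dot_sumr; apply: eq_bigr => i _; rewrite dot_delta.
have := polyhedronI (polyhedron_halfspace (\sum_(i < r) delta_mx i 0) s)
  (polyhedron_halfspace (- \sum_(i < r) delta_mx i 0) (- s)).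
congr polyhedron; apply/seteqP; split => y /=; rewrite dotNr lerN2 e.
  by move=> [h1 h2]; apply/le_anti; rewrite h1.
by move=> ->.
Qed.

Lemma polyhedron_simplex r (s : R) : polyhedron (@simplex r s).
Proof.
apply: polyhedronI; last exact: polyhedron_sum_eq.
by apply: polyhedron_forall => i; exact: polyhedron_ge.
Qed.

Lemma simplex_le r (s : R) y i : @simplex r s y -> y 0 i <= s.
Proof.
by move=> [y0 <-]; rewrite (bigD1 i)//= lerDl; apply: sumr_ge0 => j _.
Qed.

Lemma bounded_simplex r (s : R) : bounded (@simplex r s).
Proof.
exists s => y hy i; rewrite ger0_norm; last by case: hy.
exact: simplex_le hy.
Qed.

Lemma cvx_image m n (M : 'M[R]_(m, n)) (A : set 'rV[R]_m) :
  cvx A -> cvx [set y *m M | y in A].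
Proof.
move=> cA _ _ t [x Ax <-] [y Ay <-] t01; exists (x + t *: (y - x)); first exact: cA.
by rewrite mulmxDl -scalemxAl mulmxBl.
Qed.

Lemma bounded_image m n (M : 'M[R]_(m, n)) (A : set 'rV[R]_m) : bounded A ->
  bounded [set y *m M | y in A].
Proof.
move=> [b hb]; exists (\sum_i \sum_j b * `|M i j|) => _ [y Ay <-] j; rewrite mxE.
rewrite (le_trans (ler_norm_sum _ _ _))// ler_sum// => i _.
have b0 : 0 <= b by apply: le_trans (hb y Ay i).
rewrite (bigD1 j)//= -[leLHS]addr0 lerD//; last by apply: sumr_ge0 => k _; apply: mulr_ge0.
by rewrite normrM ler_wpM2r// hb.
Qed.

(** Induction over partial sums normalised by their total weight; a tail of weight 0 is treated
    apart, as it cannot be normalised. *)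
Lemma cvx_combination d (A : set 'rV[R]_d) r (M : 'M[R]_(r, d)) y :
  cvx A -> (forall i, A (row i M)) -> @simplex r 1 y -> A (y *m M).
Proof.
move=> cA AM [y0 y1].
have h (s : seq 'I_r) : 0 < \sum_(i <- s) y 0 i ->
    A ((\sum_(i <- s) y 0 i)^-1 *: \sum_(i <- s) y 0 i *: row i M).
  elim: s => [|i s IH]; first by rewrite big_nil ltxx.
  rewrite !big_cons; have [s0|s0] := ltP 0 (\sum_(i <- s) y 0 i).
    move: (IH s0); set w := \sum_(i <- s) _ in s0 *; set v := \sum_(i <- s) _ => Av.
    move=> iw0; pose t := y 0 i / (y 0 i + w).
    suff -> : (y 0 i + w)^-1 *: (y 0 i *: row i M + v) =
        w^-1 *: v + t *: (row i M - w^-1 *: v).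
      apply: cA => //; rewrite divr_ge0 ?(ltW iw0)//= ler_pdivrMr// mul1r.
      by rewrite lerDl ltW.
    rewrite scalerBr addrCA -[X in _ = _ + (X - _)]scale1r -scalerBl scalerDr !scalerA.
    congr (_ *: _ + _ *: _); first by rewrite mulrC.
    by rewrite /t; field; rewrite !gt_eqF.
  move=> iw0; have w0 : \sum_(j <- s) y 0 j = 0.
    by apply/le_anti; rewrite s0 sumr_ge0.
  rewrite w0 addr0 in iw0 *.
  have -> : \sum_(j <- s) y 0 j *: row j M = 0.
    rewrite big_seq big1// => j js; move/eqP: w0.
    rewrite psumr_eq0// => /allP/(_ j js)/implyP/(_ isT)/eqP->.
    by rewrite scale0r.
  by rewrite addr0 scalerA mulVf ?scale1r// gt_eqF.
have := h (index_enum 'I_r); rewrite y1 invr1 scale1r -mulmx_sum_row.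
exact.
Qed.

(** The rows of [Z] are the generating points; the empty polytope has r = 0, where no point has
    coordinate sum 1. *)
Lemma lattice_polytope_simplex d (P : set 'rV[R]_d) : lattice_polytope P ->
  exists r (Z : 'M[int]_(r, d)),
    P = [set y *m map_mx intr Z | y in @simplex r 1].
Proof.
move=> [S /finite_seqP[s ->] ->]; exists (size s), (\matrix_(i, j) (tnth (in_tuple s) i) 0 j).
set Z := \matrix_(_, _) _.
have rowZ i : row i (map_mx intr Z) = lattice_point (tnth (in_tuple s) i) :> 'rV[R]_d.
  by apply/rowP => j; rewrite !mxE.
apply/seteqP; split.
  apply: smallest_sub.
    apply/convex_setP; apply: cvx_image; apply: polyhedron_cvx.
    exact: polyhedron_simplex.
  move=> _ [z zs <-]; have [i ->] : exists i, z = tnth (in_tuple s) i by apply/tnthP.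
  exists (delta_mx 0 i); last by rewrite -rowE rowZ.
  split=> [j|]; first by rewrite mxE eqxx /= ler0n.
  rewrite (bigD1 i)//= mxE !eqxx big1 ?addr0// => j ji.
  by rewrite mxE (negbTE ji) andbF.
move=> _ [y hy <-] A [/convex_setP cA SA]; apply: cvx_combination => // i.
by rewrite rowZ; apply: SA; exists (tnth (in_tuple s) i) => //=; exact: mem_tnth.
Qed.

Lemma lattice_polytope_polyhedron d (P : set 'rV[R]_d) : lattice_polytope P ->
  polyhedron P /\ bounded P.
Proof.
move=> /lattice_polytope_simplex[r [Z ->]]; split.
  exact/polyhedron_image/polyhedron_simplex.
exact/bounded_image/bounded_simplex.
Qed.

Lemma dilate_simplex d r (M : 'M[R]_(r, d)) m : @simplex r 1 !=set0 ->
  dilate m [set y *m M | y in @simplex r 1] = [set y *m M | y in @simplex r m%:R].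
Proof.
move=> [a sa]; apply/seteqP; split => x.
  move=> [_ [y [y0 y1] <-] <-]; exists (m%:R *: y); last by rewrite scalemxAl.
  split=> [i|]; first by rewrite mxE mulr_ge0.
  by under eq_bigr do rewrite mxE; rewrite -mulr_sumr y1 mulr1.
(* At m = 0 rescaling is impossible; the simplex is then the origin and [a] serves as witness. *)
case: m => [|m] [y hy <-].
  have -> : y = 0.
    apply/rowP => i; rewrite mxE; apply/le_anti; rewrite (simplex_le i hy).
    by case: hy => ->.
  by exists (a *m M); rewrite ?scale0r ?mul0mx//; exists a.
exists ((m.+1%:R^-1 *: y) *m M); last first.
  by rewrite -scalemxAl scalerA mulfV ?scale1r ?pnatr_eq0.
exists (m.+1%:R^-1 *: y) => //; case: hy => y0 y1; split=> [i|].
  by rewrite mxE mulr_ge0// invr_ge0.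
by under eq_bigr do rewrite mxE; rewrite -mulr_sumr y1 mulVf ?pnatr_eq0.
Qed.

End Simplices.

(** * Counting lattice points *)

Section LatticeCount.
Context {R : realType} {d : nat}.
Implicit Types (A B C : set 'rV[R]_d) (z : 'rV[int]_d) (Z : seq 'rV[int]_d).

Lemma lattice_pointD z1 z2 :
  lattice_point (z1 + z2) = lattice_point z1 + lattice_point z2 :> 'rV[R]_d.
Proof. by apply/rowP => j; rewrite !mxE rmorphD. Qed.

Lemma lattice_pointN z : lattice_point (- z) = - lattice_point z :> 'rV[R]_d.
Proof. by apply/rowP => j; rewrite !mxE rmorphN. Qed.

Lemma bounded_lattice A : bounded A ->
  exists2 Z, uniq Z & forall z, A (lattice_point z) -> z \in Z.
Proof.
move=> [M hM]; pose N := Num.bound M.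
(* The integer vectors with entries between -N and N, as vectors of ordinals shifted by N. *)
pose f (w : 'rV['I_(N.*2.+1)]_d) : 'rV[int]_d :=
  map_mx (fun i : 'I_(N.*2.+1) => (i : nat)%:Z - N%:Z) w.
have finj : injective f.
  move=> w w' /rowP e; apply/rowP => j; apply/val_inj => /=.
  by have := e j; rewrite !mxE => /addIr [].
exists [seq f w | w <- enum {: 'rV['I_(N.*2.+1)]_d}].
  by rewrite map_inj_uniq// enum_uniq.
move=> z /hM zM; apply/mapP.
have zN j : (absz (z 0%R j) <= N)%N.
  have : `|(z 0 j)%:~R| <= N%:R :> R.
    have := zM j; rewrite mxE => /le_trans; apply; apply: ltW.
    exact: unstable.ltr_bound.
  by rewrite -intr_norm -[N%:R]/(N%:Z%:~R) ler_int; lia.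
exists (\row_j inord (absz (z 0 j + N%:Z))); first by rewrite mem_enum.
apply/rowP => j; rewrite !mxE inordK.
  by move: (z 0 j) (zN j) => a; lia.
by rewrite -addnn; move: (z 0 j) (zN j) => a; lia.
Qed.

(** Any list containing the lattice points of [A] will do, so several sets can be counted over one
    list and relations between indicators pass to counts. *)
Lemma lattice_count_sum A Z : uniq Z -> (forall z, A (lattice_point z) -> z \in Z) ->
  (lattice_count A)%:Z = \sum_(z <- Z) ind (A (lattice_point z)).
Proof.
move=> uZ AZ; pose S := [seq z <- Z | `[< A (lattice_point z) >]].
have SE : [set z | A (lattice_point z)] = [set` S].
  apply/seteqP; split => z /=; rewrite mem_filter.
    by move=> Az; rewrite AZ// andbT; apply/asboolP.
  by move=> /andP[/asboolP].
have -> : lattice_count A = size S.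
  rewrite /lattice_count SE; apply: perm_size; apply: uniq_perm.
  - exact: fset_uniq.
  - exact: filter_uniq.
  - by move=> z; rewrite in_fset_set; [apply/idP/idP; rewrite inE|apply/finite_seqP; exists S].
rewrite -sum1_size big_filter big_mkcond /= (raddf_sum Posz).
by apply: eq_bigr => z _; rewrite /ind; case: asboolP.
Qed.

Lemma lattice_count_translate A z : bounded A ->
  lattice_count [set x | A (x - lattice_point z)] = lattice_count A.
Proof.
move=> /bounded_lattice[Z uZ AZ]; apply/eqP; rewrite -eqz_nat; apply/eqP.
rewrite (lattice_count_sum (Z := [seq y + z | y <- Z])); first last.
- move=> y; rewrite /= -lattice_pointN -lattice_pointD => /AZ yZ.
  by apply/mapP; exists (y - z); rewrite ?subrK.
- by rewrite map_inj_uniq//; exact: addIr.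
rewrite (lattice_count_sum uZ AZ) big_map; apply: eq_bigr => y _.
by apply: ind_ext; rewrite /= lattice_pointD addrK.
Qed.

Lemma lattice_count_relation (I : Type) (r : seq I) (P : pred I) (a : I -> int)
    (A : I -> set 'rV[R]_d) B C : bounded C -> B `<=` C ->
  (forall i, P i -> A i `<=` C) ->
  (forall x, \sum_(i <- r | P i) a i * ind (A i x) = ind (B x)) ->
  \sum_(i <- r | P i) a i * (lattice_count (A i))%:Z = (lattice_count B)%:Z.
Proof.
move=> /bounded_lattice[Z uZ CZ] BC AC h.
rewrite (lattice_count_sum uZ); last by move=> z /BC/CZ.
under [RHS]eq_bigr do rewrite -h.
rewrite exchange_big /=; apply: eq_bigr => i Pi.
by rewrite -mulr_sumr -lattice_count_sum// => z /(AC _ Pi)/CZ.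
Qed.

End LatticeCount.

(** * Finite differences of lattice counts *)

Definition fdiff (V : zmodType) (f : nat -> V) : nat -> V := fun m => f m.+1 - f m.

Section AlternatingDifference.
Context {r : nat}.
Implicit Types (b : 'I_r -> nat) (phi : ('I_r -> nat) -> int) (s : seq 'I_r).

Definition incr b (i : 'I_r) : 'I_r -> nat := fun j => (b j + (j == i))%N.

(** The product over i in [s] of the operators 1 - T_i, where T_i raises the i-th entry by one. *)
Fixpoint altdiff phi s b : int :=
  if s is i :: s' then altdiff phi s' b - altdiff phi s' (incr b i) else phi b.

Lemma sum_incr b i : (\sum_j incr b i j = (\sum_j b j).+1)%N.
Proof.
rewrite /incr big_split /= -(addn1 (\sum_j b j)); congr addn.
by rewrite (bigD1 i)//= eqxx big1 ?addn0// => j /negbTE->.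
Qed.

(** When [phi b] depends only on the total of [b], as f(k - total), each 1 - T_i acts as a forward
    difference of [f]. The bounds keep the natural subtractions exact. *)
Lemma altdiff_iter phi (f : nat -> int) k s b :
  (forall b, (\sum_j b j <= k)%N -> phi b = f (k - \sum_j b j)%N) ->
  (size s + \sum_j b j <= k)%N ->
  altdiff phi s b = iter (size s) (@fdiff _) f (k - size s - \sum_j b j)%N.
Proof.
move=> h; elim: s b => [|i s IH] b; first by rewrite /= subn0; exact: h.
rewrite [size (i :: s)]/= [altdiff _ _ _]/= => le.
rewrite !IH ?sum_incr; [|lia..].
set m := (k - (size s).+1 - _)%N.
have -> : (k - size s - \sum_j b j = m.+1)%N by rewrite /m; lia.
by have -> : (k - size s - (\sum_j b j).+1 = m)%N by rewrite /m; lia.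
Qed.

Lemma altdiff_sum (I : Type) (t : seq I) (phi : I -> ('I_r -> nat) -> int) s b :
  \sum_(z <- t) altdiff (phi z) s b = altdiff (fun b => \sum_(z <- t) phi z b) s b.
Proof. by elim: s b => //= i s IH b; rewrite sumrB !IH. Qed.

Lemma eq_altdiff phi phi' s b : (forall b, phi b = phi' b) ->
  altdiff phi s b = altdiff phi' s b.
Proof. by move=> /funext->. Qed.

End AlternatingDifference.

Section MinkowskiRelation.
Context {R : realType} {d r : nat}.
Variables (M : 'M[R]_(r, d)) (K : set 'rV[R]_d).
Implicit Types (b : 'I_r -> nat) (x : 'rV[R]_d) (y : 'rV[R]_r).

Definition shifted_simplex (k : nat) b : set 'rV[R]_r :=
  [set y | (forall i, (b i)%:R <= y 0 i) /\ \sum_i y 0 i = k%:R].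

(** With v_i the rows of [M] and P their convex hull, this is K + (k - sum b_i) P + sum b_i v_i as
    long as the total of [b] is at most [k]. *)
Definition shifted_sum (k : nat) b : set 'rV[R]_d :=
  [set x | exists2 y, shifted_simplex k b y & K (x - y *m M)].

Hypothesis hK : polyhedron K.

Lemma shifted_simplex_sub k b : shifted_simplex k b `<=` @simplex R r k%:R.
Proof. by move=> y [y0 y1]; split => // i; apply: le_trans (y0 i); exact: ler0n. Qed.

(** In barycentric coordinates, raising [b i] multiplies the indicator by that of y_i >= b_i + 1, so
    the alternating difference is a product. Integrating over [y] returns to nonemptiness, that is
    to membership of [x]. As [s] has no repetition, the increment at [i] leaves the other factors
    alone. *)
Lemma euler_altdiff k x s b : uniq s ->
  euler std_basis (fun y => ind (shifted_simplex k b y /\ K (x - y *m M)) *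
      \prod_(i <- s) (1 - ind ((b i).+1%:R <= y 0 i)))
    (altdiff (fun b => ind (shifted_sum k b x)) s b).
Proof.
elim: s b => [|i s IH] b /=.
  move=> _; pose A := shifted_simplex k b `&` [set y | K (x + y *m (- M))].
  have pA : polyhedron A.
    apply: polyhedronI; last exact: polyhedron_preim.
    apply: polyhedronI; last exact: polyhedron_sum_eq.
    by apply: polyhedron_forall => i; exact: polyhedron_ge.
  have bA : bounded A.
    by apply: boundedS (bounded_simplex r k%:R) => y [/shifted_simplex_sub].
  rewrite (ind_ext (_ : shifted_sum k b x <-> A !=set0)).
    apply: euler_ext (euler_polytope pA bA) => y.
    by rewrite big_nil mulr1; apply: ind_ext; rewrite /A /= mulmxN.
  split=> [[y By Ky]|[y [By Ky]]]; exists y => //; first split => //=.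
    by rewrite mulmxN.
  by rewrite /= mulmxN in Ky.
move=> /andP[i_s us].
have := eulerD (IH b us) (eulerZ (-1) (IH (incr b i) us)); rewrite mulN1r.
apply: euler_ext => y; rewrite big_cons mulN1r mulrA.
have -> : \prod_(j <- s) (1 - ind ((incr b i j).+1%:R <= y 0 j)) =
    \prod_(j <- s) (1 - ind ((b j).+1%:R <= y 0 j)).
  rewrite !big_seq; apply: eq_bigr => j js; rewrite /incr.
  by rewrite (_ : j == i = false) ?addn0//; apply: contraNF i_s => /eqP<-.
rewrite -mulrBl; congr (_ * _).
have -> : ind (shifted_simplex k (incr b i) y /\ K (x - y *m M)) =
    ind (shifted_simplex k b y /\ K (x - y *m M)) * ind ((b i).+1%:R <= y 0 i).
  have [bi|bi] := boolP ((b i).+1%:R <= y 0 i).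
    rewrite [ind true]indT// mulr1; apply: ind_ext; split.
      move=> [[h1 h2] h3]; split=> //; split=> // j; apply: le_trans (h1 j).
      by rewrite ler_nat leq_addr.
    move=> [[h1 h2] h3]; split=> //; split=> // j; rewrite /incr.
    by case: eqVneq => [->|_]; rewrite ?addn1 ?addn0.
  rewrite [ind false]indF// mulr0 indF// => -[[h _] _]; have := h i.
  by rewrite /incr eqxx addn1 (negbTE bi).
by rewrite mulrBr mulr1.
Qed.

(* A point of the dilated simplex with coordinate sum at least the number of
   coordinates has a coordinate at least 1, so the product vanishes. *)
Lemma altdiff_shifted_sum k x : (0 < r)%N -> (r <= k)%N ->
  altdiff (fun b => ind (shifted_sum k b x)) (enum 'I_r) (fun=> 0%N) = 0.
Proof.
move=> r0 rk; have := @euler_altdiff k x _ (fun=> 0%N) (enum_uniq 'I_r).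
move=> /euler_unique; apply; apply: euler_ext (euler0 _) => y.
have [[[y0 ys] Ky]|nB] := pselect
  (shifted_simplex k (fun=> 0%N) y /\ K (x - y *m M)); last by rewrite (indF nB) mul0r.
have [i yi] : exists i, 1 <= y 0 i.
  apply: contrapT => /forallNP y1.
  have : \sum_i y 0 i < \sum_(i < r) 1.
    apply: ltr_sum => [|i _]; first by apply/hasP; exists (Ordinal r0); rewrite ?mem_index_enum.
    by rewrite ltNge; apply/negP/y1.
  by rewrite ys sumr_const card_ord ltr_nat ltnNge rk.
rewrite (bigD1_seq i) ?mem_enum ?enum_uniq//= [ind (1 <= _)]indT//.
by rewrite subrr mul0r mulr0.
Qed.

End MinkowskiRelation.

Section CountDifference.
Context {R : realType} {d : nat}.

(* Translating by the vertices [v] of [P] preserves the count, so the relation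
   [\prod_v ([P] - [v]) = 0] makes a finite difference of the count vanish. *)
Lemma count_fdiff_eq0 (P : set 'rV[R]_d) : lattice_polytope P -> P !=set0 ->
  exists r, forall K : set 'rV[R]_d, polyhedron K -> bounded K -> forall m,
  iter r (@fdiff _) (fun m => (lattice_count (minkowski_sum K (dilate m P)))%:Z) m = 0.
Proof.
move=> lP P0; have [r [Z PE]] := lattice_polytope_simplex lP.
have [pP bP] := lattice_polytope_polyhedron lP.
pose M : 'M[R]_(r, d) := map_mx intr Z.
have s0 : @simplex R r 1 !=set0.
  by case: P0 => x; rewrite PE => -[y hy _]; exists y.
have r0 : (0 < r)%N.
  case: s0 => y [_]; case: (r) y => // y; rewrite big_ord0 => /eqP.
  by rewrite eq_sym oner_eq0.
exists r => K pK bK m; set f := (fun m => _).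
(* Chosen so that after [r] differences starting from b = 0 the argument k - r is [m]. *)
pose k := (r + m)%N.
have dilE n : dilate n P = [set y *m M | y in @simplex R r n%:R].
  by rewrite PE dilate_simplex.
(* The shift by the sum of b_j v_j is a lattice vector, so it preserves the count; here the
   integrality of the generating points enters. *)
have sumE b : (\sum_j b j <= k)%N ->
    (lattice_count (shifted_sum M K k b))%:Z = f (k - \sum_j b j)%N.
  move=> bk; pose z : 'rV[int]_d := (\row_j (b j)%:Z) *m Z.
  have zE : lattice_point z = (\row_j (b j)%:R) *m M :> 'rV[R]_d.
    rewrite /lattice_point map_mxM /=; congr (_ *m _).
    by apply/rowP => j; rewrite !mxE.
  have sb : \sum_i (\row_j (b j)%:R : 'rV[R]_r) 0 i = (\sum_j b j)%:R.
    by rewrite natr_sum; apply: eq_bigr => i _; rewrite mxE.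
  congr Posz; rewrite -[RHS](lattice_count_translate z); last first.
    by apply: bounded_sum => //; exact: bounded_dilate.
  congr lattice_count; apply/seteqP; split => x /=.
    move=> [y [y0 ys] Ky]; exists (x - y *m M) => //.
    exists ((y - \row_j (b j)%:R) *m M); last first.
      by rewrite mulmxBl -zE addrA subrK.
    rewrite dilE; exists (y - \row_j (b j)%:R) => //; split=> [i|].
      by rewrite !mxE subr_ge0.
    rewrite natrB// -ys -sb -sumrB; apply: eq_bigr => i _.
    by rewrite !mxE.
  move=> [q Kq [p]]; rewrite dilE => -[y [y0 ys] <-] qx.
  exists (y + \row_j (b j)%:R); first split=> [i|].
  - by rewrite !mxE lerDr.
  - rewrite -(subnK bk) natrD -ys -sb -big_split; apply: eq_bigr => i _.
    by rewrite !mxE.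
  - rewrite mulmxDl -zE (_ : x - _ = q)// opprD addrCA addrC.
    by rewrite -qx addrK.
have sub b : shifted_sum M K k b `<=` shifted_sum M K k (fun=> 0%N).
  move=> x [y [y0 ys] Ky]; exists y => //; split=> // i.
  by apply: le_trans (y0 i); rewrite ler0n.
have [Y uY cY] : exists2 Y : seq 'rV[int]_d, uniq Y & forall z,
    shifted_sum M K k (fun=> 0%N) (lattice_point z) -> z \in Y.
  apply: bounded_lattice; apply: boundedS (bounded_sum bK
    (bounded_image M (bounded_simplex r k%:R))) => x [y By Ky].
  exists (x - y *m M) => //; exists (y *m M); last by rewrite subrK.
  by exists y => //; exact: shifted_simplex_sub By.
have := @altdiff_iter r (fun b => (lattice_count (shifted_sum M K k b))%:Z)
  f k (enum 'I_r) (fun=> 0%N) sumE.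
rewrite big1// addn0 size_enum_ord subn0 /k addKn => <-; last exact: leq_addr.
transitivity (\sum_(z <- Y) altdiff
  (fun b => ind (shifted_sum M K k b (lattice_point z))) (enum 'I_r) (fun=> 0%N)).
  rewrite altdiff_sum; apply: eq_altdiff => b.
  by rewrite -lattice_count_sum// => z /sub/cY.
by rewrite big1// => z _; apply: altdiff_shifted_sum => //; exact: leq_addr.
Qed.

End CountDifference.

(** * The Minkowski inverse of a polytope *)

Section MinkowskiInverse.
Context {R : realType} {d : nat}.
Implicit Types (A B K P Q : set 'rV[R]_d) (s : seq (int * set 'rV[R]_d)).

Definition diff_sum s K (v : 'rV[R]_d) : int :=
  \sum_(p <- s) p.1 * ind (diff K p.2 v).

Definition polyhedral s := forall p, p \in s -> polyhedron p.2.

(* The signed faces of [P], reflected through the origin, form an inverse of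
   [P] for the Minkowski product of indicator functions. *)
Definition face_inverse P : set (seq (int * set 'rV[R]_d)) := [set s |
  [/\ polyhedral s,
    forall p, p \in s -> p.2 `<=` P,
    forall K v, polyhedron K -> diff_sum s (minkowski_sum K P) v = ind (K v) &
    forall Q z, reduced_euler (complement_complex Q (translate z P)) =
      - diff_sum s Q (lattice_point z)]].

(** Choosing a list hides the presentation by inequalities, which is not unique; only the four
    properties are used later. *)
Definition signed_faces P := xget [::] (face_inverse P).

Lemma polyhedron_solutionsE P : polyhedron P ->
  exists k (u : 'I_k -> 'cV[R]_d) c, P = solutions u c.
Proof.
move=> [s ->]; exists (size s), (fun i => (tnth (in_tuple s) i).1),
  (fun i => (tnth (in_tuple s) i).2).
apply/seteqP; split => x /= h; first by move=> i; apply: h; exact: mem_tnth.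
by move=> p ps; have [i ->] : exists i, p = tnth (in_tuple s) i by apply/tnthP.
Qed.

Lemma translateE z A : translate z A = [set x | A (x - lattice_point z)].
Proof.
apply/seteqP; split => x /=; first by move=> [y Ay <-]; rewrite addrK.
by move=> Ax; exists (x - lattice_point z); rewrite ?subrK.
Qed.

Lemma signed_facesP P : polyhedron P -> bounded P -> P !=set0 ->
  face_inverse P (signed_faces P).
Proof.
move=> /polyhedron_solutionsE[k [u [c PE]]] bP P0; apply: xgetPex.
have sumE K v : diff_sum [seq (face_sign u J, tight_face u c J)
    | J <- enum {set 'I_k} & face_index u c J] K v =
    \sum_(J | face_index u c J) face_sign u J * ind (diff K (tight_face u c J) v).
  by rewrite /diff_sum big_map big_filter big_enum_cond.
exists [seq (face_sign u J, tight_face u c J)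
    | J <- enum {set 'I_k} & face_index u c J].
subst P; split; last 2 first.
- by move=> K v hK; rewrite sumE; apply: sum_face_cancel.
- move=> Q z; rewrite sumE.
  (* A translate changes the right-hand sides only, so the same sets [J] index the faces of all
     translates. *)
  pose c' i := c i + dot (lattice_point z) (u i).
  have trE : translate z (solutions u c) = solutions u c'.
    rewrite translateE; apply/seteqP; split => x /= h i; have := h i;
      by rewrite dotBl lerBlDr.
  have tightE x : tight u c' x = tight u c (x - lattice_point z).
    by apply/setP => i; rewrite !inE dotBl subr_eq.
  have solE x : solutions u c' x <-> solutions u c (x - lattice_point z).
    by rewrite -trE translateE.
  have idxE J : face_index u c' J = face_index u c J.
    apply/asboolP/asboolP => -[x /stratumT[h1 h2]].
      exists (x - lattice_point z); apply/stratumT.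
      by split; [apply/solE|rewrite -tightE].
    exists (x + lattice_point z); apply/stratumT.
    by split; [apply/solE|rewrite tightE]; rewrite addrK.
  have bt : bounded (solutions u c').
    have [M hM] := bP; have [N hN] := bounded_point (lattice_point z : 'rV[R]_d).
    exists (M + N) => x /solE/hM h j.
    have -> : x 0 j = (x - lattice_point z) 0 j + lattice_point z 0 j.
      by rewrite !mxE subrK.
    by rewrite (le_trans (ler_normD _ _))// lerD// hN.
  have t0 : solutions u c' !=set0.
    by have [x Px] := P0; exists (x + lattice_point z); apply/solE; rewrite addrK.
  rewrite trE reduced_euler_complement//; congr (- _).
  under eq_bigl do rewrite idxE.
  apply: eq_bigr => J _; congr (_ * _); apply: ind_ext; split.
    move=> [x [[/solE Px]]]; rewrite tightE => Jx Qx.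
    by exists (x - lattice_point z); [split|rewrite addrC subrK].
  move=> [y [Py Jy] Qy]; exists (lattice_point z + y); split => //; split.
    by apply/solE; rewrite addrC addKr.
  by rewrite tightE addrC addKr.
- by move=> _ /mapP[J _ ->]; exact: polyhedron_tight_face.
- by move=> _ /mapP[J _ ->]; exact: tight_face_sub.
Qed.

Lemma diff_sum_cat s s' K v : diff_sum (s ++ s') K v = diff_sum s K v + diff_sum s' K v.
Proof. exact: big_cat. Qed.

Definition opp_sum s : seq (int * set 'rV[R]_d) := [seq (- p.1, p.2) | p <- s].

Lemma diff_sum_opp s K v : diff_sum (opp_sum s) K v = - diff_sum s K v.
Proof.
by rewrite /diff_sum big_map -sumrN; apply: eq_bigr => p _; rewrite mulNr.
Qed.

Lemma diffAC A B K : diff (diff A B) K = diff (diff A K) B.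
Proof.
by apply/seteqP; split => x [y By [z Bz Axyz]]; exists z => //; exists y => //;
  rewrite addrAC.
Qed.

Lemma diff_minkowski_sum A B K :
  diff (minkowski_sum A B) K = minkowski_sum (diff A K) B.
Proof.
apply/seteqP; split => x.
  move=> [y Ky [a Aa [b Bb e]]]; exists (a - y); first by exists y; rewrite ?subrK.
  by exists b => //; rewrite addrAC e addrK.
move=> [a [y Ky Aay] [b Bb <-]]; exists y => //; exists (a + y) => //.
by exists b => //; rewrite addrAC.
Qed.

(** Having an inverse, [P] can be cancelled: expand each K - p as the signed sum of the K - p + P -
    q over the faces q, and exchange the two sums. *)
Lemma diff_sum_cancel s P : polyhedron P -> bounded P -> P !=set0 -> polyhedral s ->
  (forall K v, polyhedron K -> diff_sum s (minkowski_sum K P) v = 0) ->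
  forall K v, polyhedron K -> diff_sum s K v = 0.
Proof.
move=> pP bP P0 ps h K v pK.
have [pF _ invP _] := signed_facesP pP bP P0.
rewrite /diff_sum big_seq.
under eq_bigr => p sp.
  rewrite -(invP _ _ (polyhedron_diff pK (ps _ sp))) /diff_sum mulr_sumr.
  over.
rewrite exchange_big /= big_seq big1// => q Fq.
transitivity (q.1 * diff_sum s (minkowski_sum (diff K q.2) P) v); last first.
  by rewrite h ?mulr0//; apply: polyhedron_diff => //; exact: pF.
rewrite /diff_sum mulr_sumr [RHS]big_seq; apply: eq_bigr => p _.
by rewrite mulrCA -!diff_minkowski_sum diffAC.
Qed.

(** Connectedness of the segment: [P2] occupies a final closed piece and [P1] an initial one, and
    together they cover it. *)
Lemma segment_meets P1 P2 x y : polyhedron P1 -> polyhedron P2 ->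
  cvx (P1 `|` P2) -> P1 x -> P2 y ->
  exists2 t, 0 <= t <= 1 & (P1 `&` P2) (x + t *: (y - x)).
Proof.
move=> p1 p2 cU P1x P2y; set w := y - x.
have cover t : 0 <= t <= 1 -> (P1 `|` P2) (x + t *: w).
  by move=> t01; apply: cU => //; [left|right].
have y1 : P2 (x + 1 *: w) by rewrite scale1r subrKC.
have x0 : P1 (x + 0 *: (- w)) by rewrite scale0r addr0.
have fromx : P2 (x + 0 *: w) ->
    exists2 t, 0 <= t <= 1 & (P1 `&` P2) (x + t *: w).
  by move=> h; exists 0; rewrite ?lexx ?ler01//; split => //; rewrite scale0r addr0.
have [h|[a a1 ha]] := polyhedron_line_min p2 y1.
  by apply: fromx; apply: h; exact: ler01.
have [a0|a0] := leP a 0; first by apply: fromx; apply/ha => //; exact: ler01.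
exists a; first by rewrite ltW.
split; last by apply/ha.
have [h|[b b0 hb]] := polyhedron_line_min p1 x0.
  by have := h (- a); rewrite oppr_le0 (ltW a0) scaleNr scalerN opprK; exact.
have hb' t : 0 <= t -> P1 (x + t *: w) <-> t <= - b.
  move=> t0; have := hb (- t); rewrite oppr_le0 t0 scaleNr scalerN opprK lerNr.
  exact.
apply/hb'; first exact: ltW.
(* If the first piece ended before the second began, the midpoint of the gap would be uncovered. *)
rewrite leNgt; apply/negP => ba.
have [||/ha] := cover ((a - b) / 2); first by apply/andP; split; lra.
  by move=> /hb'; lra.
by lra.
Qed.

(** On the segment from [x] to [y], a point of the intersection and its mirror image about the
    midpoint, which lies in the union, add up to x + y. *)
Lemma minkowski_sum_union_inter P1 P2 : polyhedron P1 -> polyhedron P2 ->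
  cvx (P1 `|` P2) ->
  minkowski_sum (P1 `|` P2) (P1 `&` P2) = minkowski_sum P1 P2.
Proof.
move=> p1 p2 cU; apply/seteqP; split.
  move=> _ [x [xP|xP] [y [y1 y2] <-]]; first by exists x => //; exists y.
  by exists y => //; exists x => //; rewrite addrC.
move=> _ [x xP [y yP <-]].
have [t /andP[t0 t1] hz] := segment_meets p1 p2 cU xP yP.
exists (x + (1 - t) *: (y - x)).
  by apply: cU; [left|right|apply/andP; split; lra].
exists (x + t *: (y - x)) => //.
by rewrite addrACA -scalerDl subrK scale1r -addrA subrKC.
Qed.

(** Inclusion-exclusion for indicators, multiplied by the indicator of [x - K] and passed to
    nonemptiness. *)
Lemma minkowski_sum_valuation K P1 P2 x : polyhedron K ->
  polyhedron P1 -> polyhedron P2 -> bounded P1 -> bounded P2 ->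
  polyhedron (P1 `|` P2) ->
  ind (minkowski_sum K (P1 `|` P2) x) + ind (minkowski_sum K (P1 `&` P2) x) =
  ind (minkowski_sum K P1 x) + ind (minkowski_sum K P2 x).
Proof.
move=> pK p1 p2 b1 b2 pU.
have pKx : polyhedron [set y | K (x + - y)].
  exact: (polyhedron_opp (polyhedron_translate x pK)).
pose A P := P `&` [set y | K (x + - y)].
have AE P : ind (minkowski_sum K P x) = ind (A P !=set0).
  apply: ind_ext; split=> [[k Kk [p Pp e]]|[p [Pp Kp]]].
    by exists p; split => //=; rewrite -e addrK.
  by exists (x - p) => //; exists p => //; rewrite subrK.
rewrite !AE; apply/eqP; rewrite -subr_eq0; apply/eqP.
pose s : seq (int * set 'rV[R]_d) :=
  [:: (1, P1 `|` P2); (1, P1 `&` P2); (-1, P1); (-1, P2)].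
have bU : bounded (P1 `|` P2).
  have [M hM] := b1; have [N hN] := b2; exists (Num.max M N).
  by move=> y [/hM|/hN] h j; rewrite le_max h ?orbT.
have pI := polyhedronI p1 p2.
have bI : bounded (P1 `&` P2) by apply: boundedS b1 => y [].
have hs p : p \in s -> polyhedron p.2 /\ bounded p.2.
  by rewrite !inE => /or4P[] /eqP-> /=.
have n0 : ~ ((set0 : set 'rV[R]_d) !=set0) by move=> [].
have h : \sum_(p <- s | p \in s) p.1 * ind (A p.2 !=set0) = 0.
  rewrite (euler_relation _ polyhedron_set0 bounded_set0) ?indF// => [p ps|y].
    have [pp bp] := hs p ps; split; first exact: polyhedronI.
    by apply: boundedS bp => y [].
  rewrite indF// -big_seq /s !big_cons big_nil /=.
  have [Ky|nKy] := pselect (K (x + - y)); last first.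
    by rewrite !(@indF (A _ y)) // => -[].
  have e P : ind (A P y) = ind (P y) by apply: ind_ext; split=> [[]|].
  rewrite !e.
  have [h1|h1] := pselect (P1 y); have [h2|h2] := pselect (P2 y).
  - by rewrite !indT//; left.
  - by rewrite (indF h2) (indT h1) indT ?indF//; [move=> []|left].
  - by rewrite (indF h1) (indT h2) indT ?indF//; [move=> []|right].
  - by rewrite !indF// => -[].
move: h; rewrite -big_seq /s !big_cons big_nil /=; lia.
Qed.

End MinkowskiInverse.

(** * The valuation property *)

Lemma complement_euler_valuation (R : realType) (d : nat) (Q : set 'rV[R]_d) :
  polyhedron Q -> is_valuation (complement_euler Q).
Proof.
move=> pQ; split; first by rewrite /complement_euler eqxx.
move=> P1 P2 /lattice_polytope_polyhedron[p1 b1] /lattice_polytope_polyhedron[p2 b2].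
move=> /lattice_polytope_polyhedron[pU bU] /lattice_polytope_polyhedron[pI bI].
have ceE P : polyhedron P -> bounded P -> P !=set0 ->
    complement_euler Q P = - diff_sum (signed_faces P) Q 0.
  move=> pP bP P0; rewrite /complement_euler ifF; last first.
    by apply/eqP => PE; rewrite PE in P0; case: P0.
  have [_ _ _ /(_ Q 0)] := signed_facesP pP bP P0.
  have lp0 : lattice_point 0 = 0 :> 'rV[R]_d by apply/rowP => j; rewrite !mxE.
  rewrite lp0 translateE lp0 => <-; congr (reduced_euler (complement_complex _ _)).
  by apply/seteqP; split => x /=; rewrite subr0.
have [[x1 hx1]|/set0P/negP/negPn/eqP->] := pselect (P1 !=set0); last first.
  by rewrite set0U set0I /complement_euler eqxx add0r subr0.
have [[x2 hx2]|/set0P/negP/negPn/eqP->] := pselect (P2 !=set0); last first.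
  by rewrite setU0 setI0 /complement_euler eqxx addr0 subr0.
have cU := polyhedron_cvx pU.
have U0 : P1 `|` P2 !=set0 by exists x1; left.
have I0 : P1 `&` P2 !=set0.
  by have [t _ hz] := segment_meets p1 p2 cU hx1 hx2; eexists; exact: hz.
have P10 : P1 !=set0 by exists x1.
have P20 : P2 !=set0 by exists x2.
rewrite !ceE//.
have [fU _ iU _] := signed_facesP pU bU U0.
have [fI _ iI _] := signed_facesP pI bI I0.
have [f1 _ i1 _] := signed_facesP p1 b1 P10.
have [f2 _ i2 _] := signed_facesP p2 b2 P20.
pose s := signed_faces (P1 `|` P2) ++ signed_faces (P1 `&` P2) ++
  opp_sum (signed_faces P1 ++ signed_faces P2).
have sE K v : diff_sum s K v = diff_sum (signed_faces (P1 `|` P2)) K v +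
    diff_sum (signed_faces (P1 `&` P2)) K v -
    (diff_sum (signed_faces P1) K v + diff_sum (signed_faces P2) K v).
  by rewrite !diff_sum_cat diff_sum_opp diff_sum_cat addrA.
have ps : polyhedral s.
  move=> p; rewrite !mem_cat => /or3P[/fU|/fI|]//.
  by move=> /mapP[q + ->]; rewrite mem_cat => /orP[/f1|/f2].
suff : diff_sum s Q 0 = 0 by rewrite sE; lia.
have UI0 : minkowski_sum (P1 `|` P2) (P1 `&` P2) !=set0.
  by have [a Ua] := U0; have [b Ib] := I0; exists (a + b); exists a => //; exists b.
apply: (diff_sum_cancel (polyhedron_sum pU pI) (bounded_sum bU bI) UI0 ps) => //.
(* Since the union plus the intersection equals P1 + P2, the four inverses leave [K] plus, in turn,
   the intersection, the union, P2 and P1, whose indicators balance. *)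
move=> K v pK; rewrite sE.
rewrite {1}[minkowski_sum (P1 `|` P2) _]minkowski_sumC minkowski_sumA iU;
  last exact: polyhedron_sum.
rewrite minkowski_sumA iI; last exact: polyhedron_sum.
rewrite -minkowski_sumA minkowski_sum_union_inter//.
rewrite {1}[minkowski_sum P1 P2]minkowski_sumC minkowski_sumA i1;
  last exact: polyhedron_sum.
rewrite minkowski_sumA i2; last exact: polyhedron_sum.
have := minkowski_sum_valuation v pK p1 p2 b1 b2 pU.
lia.
Qed.

(** * Reciprocity *)

Section FiniteDifferences.

Lemma iter_fdiff0 (V : zmodType) n : iter n (@fdiff V) (fun=> 0) = (fun=> 0).
Proof. by elim: n => //= n ->; apply/funext => m; rewrite /fdiff subrr. Qed.

Lemma iter_fdiff_ge (V : zmodType) (f : nat -> V) r n : (r <= n)%N ->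
  iter r (@fdiff V) f = (fun=> 0) -> iter n (@fdiff V) f = (fun=> 0).
Proof. by move=> /subnK<- h; rewrite iterD h iter_fdiff0. Qed.

Lemma iter_fdiffB (V : zmodType) n (f g : nat -> V) :
  iter n (@fdiff V) (fun m => f m - g m) =
  (fun m => iter n (@fdiff V) f m - iter n (@fdiff V) g m).
Proof.
by elim: n => //= n ->; apply/funext => m; rewrite /fdiff opprD addrACA -opprD.
Qed.

Lemma iter_fdiff_intr (R : pzRingType) n (f : nat -> int) :
  iter n (@fdiff R) (fun m => (f m)%:~R) = (fun m => (iter n (@fdiff int) f m)%:~R).
Proof. by elim: n => //= n ->; apply/funext => m; rewrite /fdiff rmorphB. Qed.

Lemma iter_fdiff_sum (I : Type) (s : seq I) (a : I -> int) (f : I -> nat -> int) n :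
  iter n (@fdiff int) (fun m => \sum_(i <- s) a i * f i m) =
  (fun m => \sum_(i <- s) a i * iter n (@fdiff int) (f i) m).
Proof.
elim: n => //= n ->; apply/funext => m; rewrite /fdiff -sumrB.
by apply: eq_bigr => i _; rewrite mulrBr.
Qed.

(** The difference of a sequence supported at 0 is again supported at 0, with its value negated; so
    the n-th difference at 0 is [g 0] up to sign. *)
Lemma fdiff_determines_init (V : zmodType) (g : nat -> V) n :
  (forall m, g m.+1 = 0) -> iter n (@fdiff V) g = (fun=> 0) -> g 0%N = 0.
Proof.
elim: n g => [|n IH] g g1; first by move=> /= ->.
rewrite iterSr => /IH h; apply/oppr_inj; rewrite oppr0 -{}h.
  by rewrite /fdiff g1 sub0r.
by move=> m; rewrite /fdiff !g1 subrr.
Qed.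

Lemma size_fdiff_poly (R : idomainType) (p : {poly R}) n : (size p <= n.+1)%N ->
  (size (p \Po ('X + 1) - p)%R <= n)%N.
Proof.
elim/poly_ind: p n => [|p c IH] n sp; first by rewrite comp_poly0 subrr size_poly0.
have [->|p0] := eqVneq p 0.
  by rewrite mul0r add0r comp_polyC subrr size_poly0.
have sp' : (size p <= n)%N.
  move: sp; rewrite size_MXaddC (negbTE p0) /=; lia.
rewrite comp_poly_MXaddC.
have -> : (p \Po ('X + 1)) * ('X + 1) + c%:P - (p * 'X + c%:P) =
    (p \Po ('X + 1) - p) * 'X + (p \Po ('X + 1)) by ring.
apply: leq_trans (size_polyD _ _) _; rewrite geq_max size_comp_poly2 ?sp' ?andbT; last first.
  by rewrite size_XaddC.
case: n sp sp' => [|n] _ sp'; first by move: sp'; rewrite leqn0 size_poly_eq0 (negbTE p0).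
have [->|q0] := eqVneq (p \Po ('X + 1) - p) 0; first by rewrite mul0r size_poly0.
by rewrite size_mulX// ltnS; apply: IH.
Qed.

Lemma iter_fdiff_poly (R : idomainType) (p : {poly R}) a n : (size p <= n)%N ->
  iter n (@fdiff R) (fun m => p.[m%:R + a]) = (fun=> 0).
Proof.
elim: n p => [|n IH] p sp.
  by apply/funext => m; move: sp; rewrite leqn0 size_poly_eq0 => /eqP->; rewrite /= horner0.
rewrite iterSr -(IH _ (size_fdiff_poly sp)); congr (iter _ _ _).
apply/funext => m; rewrite /fdiff hornerD hornerN horner_comp !hornerE.
by rewrite -natr1 addrAC.
Qed.

End FiniteDifferences.

Theorem theorem4p8 (R : realType) (d : nat) (Q : set 'rV[R]_d)
    (hQ : lattice_polytope Q) (hQ0 : Q !=set0) :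
  is_valuation (complement_euler Q) /\
  forall P : set 'rV[R]_d, lattice_polytope P -> P !=set0 ->
    finite_set [set p : 'rV[int]_d |
      reduced_euler (complement_complex Q (translate p P)) != 0] /\
    forall E : {poly {poly R}}, is_ehrhart_polynomial P Q E ->
      E.[-1, 1] =
      - (\sum_(p \in [set: 'rV[int]_d])
           reduced_euler (complement_complex Q (translate p P)))%:~R.
Proof.
have [pQ bQ] := lattice_polytope_polyhedron hQ.
split; first exact: complement_euler_valuation.
move=> P hP P0; have [pP bP] := lattice_polytope_polyhedron hP.
have [pF subF invF eulerF] := signed_facesP pP bP P0.
set s := signed_faces P in pF subF invF eulerF.
(* The translate of [P] by [p] meets [Q] only if [p] lies in [Q - P]; for every other [p] the
   reduced characteristic is 0. *)
have [Z uZ QPZ] := bounded_lattice (bounded_diff bQ bP).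
have dsub p A : p \in s -> diff A p.2 `<=` diff A P.
  by move=> /subF pP' x [y py Axy]; exists y => //; exact: pP'.
have vanish p : p \notin Z ->
    reduced_euler (complement_complex Q (translate p P)) = 0.
  move=> pZ; rewrite eulerF /diff_sum big_seq big1 ?oppr0// => q qs.
  by rewrite indF ?mulr0// => /(dsub _ _ qs)/QPZ; exact/negP.
split.
  apply: (@sub_finite_set _ _ [set` Z]); last by apply/finite_seqP; exists Z.
  by move=> p /=; apply: contraNT => /vanish->.
move=> E hE.
pose S m := minkowski_sum Q (dilate m P).
have pS m : polyhedron (S m) by apply: polyhedron_sum => //; exact: polyhedron_dilate.
have bS m : bounded (S m) by apply: bounded_sum => //; exact: bounded_dilate.
pose H m : int := \sum_(p <- s) p.1 * (lattice_count (diff (S m) p.2))%:Z.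
have S0 : S 0%N = Q.
  rewrite /S dilate0//; apply/seteqP; split => x /=.
    by move=> [q Qq [_ -> <-]]; rewrite addr0.
  by move=> Qx; exists x => //; exists 0; rewrite ?addr0.
have H0 : \sum_(p \in [set: 'rV[int]_d])
    reduced_euler (complement_complex Q (translate p P)) = - H 0%N.
  rewrite -(fsbig_widen [set` Z])//; last by move=> p [_ /negP /vanish].
  rewrite -fsbig_seq// /H -sumrN S0.
  under eq_bigr do rewrite eulerF /diff_sum -sumrN.
  rewrite exchange_big /= big_seq [RHS]big_seq; apply: eq_bigr => q qs.
  rewrite sumrN -mulr_sumr -lattice_count_sum// => z /(dsub _ _ qs).
  exact: QPZ.
have H1 m : H m.+1 = (lattice_count (S m))%:Z.
  rewrite /H big_seq.
  apply: (lattice_count_relation (C := diff (S m.+1) P `|` S m)).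
  - have [M hM] := bounded_diff (bS m.+1) bP; have [N hN] := bS m.
    by exists (Num.max M N) => x [/hM|/hN] h j; rewrite le_max h ?orbT.
  - by move=> x; right.
  - by move=> p ps x /(dsub _ _ ps); left.
  - move=> x; rewrite -big_seq -invF// /diff_sum /S dilateS ?minkowski_sumA//.
    exact: polyhedron_cvx.
have Hr : exists r, iter r (@fdiff int) H = (fun=> 0).
  have [r hr] := count_fdiff_eq0 hP P0; exists r.
  rewrite iter_fdiff_sum; apply/funext => m; rewrite big_seq big1// => p ps.
  (* Q + mP - F is (Q - F) + mP, and [r] depends on [P] alone, so one order of difference serves all
     faces. *)
  have -> : (fun m => (lattice_count (diff (S m) p.2))%:Z) =
      (fun m => (lattice_count (minkowski_sum (diff Q p.2) (dilate m P)))%:Z).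
    by apply/funext => n; rewrite diff_minkowski_sum.
  rewrite hr ?mulr0//; first by apply: polyhedron_diff => //; exact: pF.
  by apply: bounded_diff => //; apply: boundedS bP; exact: subF.
have [r hr] := Hr.
(* The inner variable of [E] is the multiplicity of [Q]; setting it to 1 leaves a polynomial in the
   multiplicity of [P]. *)
pose L : {poly R} := map_poly (horner_eval 1) E.
have LE a : L.[a] = E.[a, 1].
  by rewrite -(hornerC a 1) -/(horner_eval 1 a%:P) horner_map /= /horner_eval hornerC.
have Lcount m : L.[m%:R] = (H m.+1)%:~R.
  rewrite LE H1 -pmulrn -[1]/(1%:R : R) hE dilate1 minkowski_sumC; reflexivity.
rewrite H0 mulrNz opprK -LE.
apply/eqP; rewrite -subr_eq0; apply/eqP.
pose n := maxn (size L) r.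
(* L(m - 1) - H(m) vanishes for m >= 1, and its n-th difference vanishes because [n] exceeds the
   degree of [L] and is at least [r]; hence it vanishes at 0 as well, which says L(-1) = H(0). *)
have := @fdiff_determines_init R (fun m => L.[m%:R + -1] - (H m)%:~R) n.
rewrite add0r; apply=> [m|].
  by rewrite -natr1 addrK Lcount subrr.
rewrite iter_fdiffB iter_fdiff_intr iter_fdiff_poly ?leq_maxl//.
by rewrite (iter_fdiff_ge (leq_maxr _ _) hr); apply/funext => m; rewrite subrr.
Qed.
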